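(* For each $n\in\mathbb N$ let $E^{(n)}_1,\dots,E^{(n)}_n$ be real numbers that are linearly independent over $\mathbb Q$, and let $d^{(n)}_1,\dots,d^{(n)}_n>0$ be weights (which may depend on $n$). Let $Z_n(t)=\sum_{j=1}^n d^{(n)}_je^{-itE^{(n)}_j}$, $(\Delta Z_n)^2=\sum_{j=1}^n (d_j^{(n)})^2$ and $Y_n(t)=Z_n(t)/\Delta Z_n\in\mathbb C\cong\mathbb R^2$, where $t$ is a random time distributed according to the infinite time average. Suppose the weights satisfy the Lyapunov condition: there exists $q>1$ such that $\lim_{n\to\infty}R_q^n=0$. Then $Y_n$ converges in distribution, as $n\to\infty$, to the standard two-dimensional Gaussian with density $P_Y(\boldsymbol y)=\frac1\pi e^{-\|\boldsymbol y\|^2}$ on $\mathbb R^2$. Conversely, if there is no $q>1$ with $\lim_{n\to\infty}R_q^n=0$, then $Y_n$ does not converge in distribution to this Gaussian.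
   Context: Infinite time average: $\overline{f(t)}:=\lim_{T\to\infty}\frac1T\int_0^Tf(t)\,dt$. ''$t$ distributed according to the infinite time average'' means that the law of a random variable $F(t)$ is the limit as $T\to\infty$ of the law of $F(t)$ with $t$ uniform on $[0,T]$; equivalently $\overline{g(F(t))}$ is the expectation of $g(F)$ for bounded continuous $g$. For weights $d_1,\dots,d_n$ define $R_q^n:=\dfrac{\sum_{j=1}^n d_j^{2q}}{\left(\sum_{j=1}^n d_j^2\right)^q}$. *)

(* Defs.v *)
From Stdlib Require Import Reals QArith Qreals List.
From Coquelicot Require Import Coquelicot.
Open Scope R_scope.

Definition sumR (n : nat) (f : nat -> R) : R :=
  fold_right Rplus 0 (map f (seq 0 n)).

Definition sumC (n : nat) (f : nat -> C) : C :=
  fold_right Cplus (RtoC 0) (map f (seq 0 n)).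

Definition Q_lin_indep (n : nat) (E : nat -> R) : Prop :=
  forall c : nat -> Q,
    sumR n (fun j => Q2R (c j) * E j) = 0 ->
    forall j, (j < n)%nat -> Q2R (c j) = 0.

Definition cexp_mi (theta : R) : C := (cos theta, - sin theta).

Definition Zn (n : nat) (E d : nat -> R) (t : R) : C :=
  sumC n (fun j => Cmult (RtoC (d j)) (cexp_mi (t * E j))).

Definition DeltaZ (n : nat) (d : nat -> R) : R := sqrt (sumR n (fun j => d j ^ 2)).

Definition Yn (n : nat) (E d : nat -> R) (t : R) : C :=
  Cmult (RtoC (/ DeltaZ n d)) (Zn n E d t).

Definition Rq (q : R) (n : nat) (d : nat -> R) : R :=
  sumR n (fun j => Rpower (d j) (2 * q)) / Rpower (sumR n (fun j => d j ^ 2)) q.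

Definition time_avg (f : R -> R) (l : R) : Prop :=
  filterlim (fun T => RInt f 0 T / T) (Rbar_locally p_infty) (locally l).

Definition bounded_continuous (g : C -> R) : Prop :=
  (forall y : C, continuous g y) /\ exists M, forall y, Rabs (g y) <= M.

Definition gauss_density (y : C) : R := / PI * exp (- ((fst y) ^ 2 + (snd y) ^ 2)).

Definition gauss_expect (g : C -> R) (l : R) : Prop :=
  exists h : R -> R,
    (forall y1, is_RInt_gen (fun y2 => g (y1, y2) * gauss_density (y1, y2))
                  (Rbar_locally m_infty) (Rbar_locally p_infty) (h y1)) /\
    is_RInt_gen h (Rbar_locally m_infty) (Rbar_locally p_infty) l.

(* Y_n (with t distributed by the infinite time average) converges in
   distribution to the standard 2-d Gaussian: for every bounded continuous g,
   the time averages of g(Y_n(t)) exist and converge to E[g(Y)]. *)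
Definition conv_gauss (Y : nat -> R -> C) : Prop :=
  forall g : C -> R, bounded_continuous g ->
    exists a : nat -> R,
      (forall n, time_avg (fun t => g (Y n t)) (a n)) /\
      exists l, gauss_expect g l /\ is_lim_seq a l.

Definition lyapunov (d : nat -> nat -> R) : Prop :=
  exists q : R, 1 < q /\ is_lim_seq (fun n => Rq q n (d n)) 0.

(* Main.v *)
Require Import Defs.
From Stdlib Require Import Reals QArith Qreals List Lra Lia.
From Coquelicot Require Import Coquelicot.
Open Scope R_scope.

(** Write [w_j = d_j / DeltaZ].  Since the frequencies are rationally
    independent, time averages factorise over the oscillators, so the
    characteristic function of [Y_n] at [xi] is [prod_j J_0 (|xi| w_j)].
    For [|x| <= 1] the Bessel function satisfies
    [exp (- x^2/4 - x^4/8) <= J_0 x <= exp (- x^2/4 - x^4/128)], hence, as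
    [sum_j w_j^2 = 1], the characteristic function tends to
    [exp (- |xi|^2/4)] exactly when [R_2^n = sum_j w_j^4] tends to 0.  If some
    [R_q^n] tends to 0 with [q > 1], then so does [max_j w_j], and
    [sum_j w_j^4 <= max_j w_j^2]; conversely [xi = (1, 0)] alone recovers
    [R_2^n].  To pass from characters to a bounded continuous [g], one
    approximates [g] by a trigonometric polynomial up to
    [eps (1 + |y|^2)] on the whole plane; the second moments are bounded. *)

(** * Trigonometric polynomials and time averages *)

(** Levy's continuity theorem is replaced by explicit estimates. Time averages and Gaussian
    expectations are treated as relations, [has_mean] and [gauss_expect], that are linear and
    monotone, and every limit is an error bound between such values. The quadratic weight in the
    approximation takes the place of tightness: a trigonometric polynomial cannot be uniformly close
    to a general bounded continuous [g] on the whole plane, but a quadratic error is harmless once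
    both laws have second moment at most 1.

    Independence has to be proved for almost periodic functions rather than trigonometric
    polynomials, because cos (x cos theta) is only a uniform limit of the latter. All characters are
    real: a cosine with a free phase stands for a complex exponential.

    The constants 1/8 and 1/128 bracket the coefficient 1/64 in log J_0(x) = - x^2/4 - x^4/64 - ...
    The lower bound keeps the characteristic function from dropping below the Gaussian one in the
    limit; the quartic term of the upper bound is what detects R_2^n in the converse. *)

(** Used both over time and over the plane, with [F] the admissible phases. The constructors take
    pointwise equations, so functions are never compared as functions. *)
Inductive trig {X : Type} (F : (X -> R) -> Prop) : (X -> R) -> Prop :=
| trig_cos l phi f : F l -> (forall x, f x = cos (l x + phi)) -> trig F f
| trig_scal c f g : trig F f -> (forall x, g x = c * f x) -> trig F g
| trig_plus f g h : trig F f -> trig F g -> (forall x, h x = f x + g x) ->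
    trig F h.

Definition phase_group {X : Type} (F : (X -> R) -> Prop) : Prop :=
  F (fun _ => 0) /\
  (forall k l, F k -> F l -> F (fun x => k x + l x)) /\
  (forall k l, F k -> F l -> F (fun x => k x - l x)).

Section Trig.
Context {X : Type} (F : (X -> R) -> Prop) (HF : phase_group F).

Lemma trig_ext f g : trig F f -> (forall x, g x = f x) -> trig F g.
Proof.
  intros Hf Hg; apply (trig_scal F 1 f); [exact Hf|].
  intros x; rewrite Hg; ring.
Qed.

Lemma trig_const c : trig F (fun _ => c).
Proof.
  destruct HF as [H0 _].
  apply (trig_scal F c (fun _ => cos (0 + 0))).
  - now apply (trig_cos F (fun _ => 0) 0).
  - intros _; rewrite Rplus_0_r, cos_0; ring.
Qed.

(** Product-to-sum formula: the new phases are the sum and the difference of the old ones, which is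
    the closure that [phase_group] grants. *)
Lemma trig_mult f g : trig F f -> trig F g -> trig F (fun x => f x * g x).
Proof.
  destruct HF as (_ & Hadd & Hsub).
  intros Hf Hg; induction Hf as [k phi f Hk Ek|c f1 f _ IH Ef|f1 f2 f _ IH1 _ IH2 Ef].
  - induction Hg as [l psi g Hl El|c g1 g _ IH Eg|g1 g2 g _ IH1 _ IH2 Eg].
    + apply (trig_plus F
        (fun x => / 2 * cos ((k x + l x) + (phi + psi)))
        (fun x => / 2 * cos ((k x - l x) + (phi - psi)))).
      * apply (trig_scal F (/ 2) (fun x => cos ((k x + l x) + (phi + psi)))); [|easy].
        now apply (trig_cos F (fun x => k x + l x) (phi + psi)); [apply Hadd|].
      * apply (trig_scal F (/ 2) (fun x => cos ((k x - l x) + (phi - psi)))); [|easy].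
        now apply (trig_cos F (fun x => k x - l x) (phi - psi)); [apply Hsub|].
      * intros x; rewrite Ek, El.
        replace (k x + l x + (phi + psi)) with ((k x + phi) + (l x + psi)) by ring.
        replace (k x - l x + (phi - psi)) with ((k x + phi) - (l x + psi)) by ring.
        generalize (k x + phi) (l x + psi); intros a b.
        rewrite cos_plus, cos_minus; field.
    + apply (trig_scal F c _ _ IH); intros x; rewrite Eg; ring.
    + apply (trig_plus F _ _ _ IH1 IH2); intros x; rewrite Eg; ring.
  - apply (trig_scal F c _ _ IH); intros x; rewrite Ef; ring.
  - apply (trig_plus F _ _ _ IH1 IH2); intros x; rewrite Ef; ring.
Qed.

End Trig.

Lemma trig_incl {X : Type} (F G : (X -> R) -> Prop) f :
  (forall l, F l -> G l) -> trig F f -> trig G f.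
Proof.
  intros HFG Hf; induction Hf as [k phi f Hk Ek|c f1 f _ IH Ef|f1 f2 f _ IH1 _ IH2 Ef].
  - exact (trig_cos G k phi f (HFG k Hk) Ek).
  - exact (trig_scal G c f1 f IH Ef).
  - exact (trig_plus G f1 f2 f IH1 IH2 Ef).
Qed.

(* [bern m u f k] is the expectation of [f (k + N)] for [N] binomial with
   parameters [m] and [u]: the Bernstein polynomial, written recursively. *)
Fixpoint bern (m : nat) (u : R) (f : nat -> R) (k : nat) : R :=
  match m with
  | O => f k
  | S m => u * bern m u f (S k) + (1 - u) * bern m u f k
  end.

(** The recursion of [bern] uses only sums and products. Both approximation results below take their
    approximants from here. *)
Lemma trig_bern {X : Type} (F : (X -> R) -> Prop) (u : X -> R)
  (f : X -> nat -> R) (m : nat) :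
  phase_group F -> trig F u -> (forall k, trig F (fun x => f x k)) ->
  forall k, trig F (fun x => bern m (u x) (f x) k).
Proof.
  intros HF Hu Hf; induction m as [|m IH]; intros k; simpl; [apply Hf|].
  eapply trig_plus; [| |easy]; apply trig_mult; try easy.
  apply (trig_plus F (fun _ => 1) (fun x => (-1) * u x)).
  - now apply trig_const.
  - exact (trig_scal F (-1) u _ Hu (fun _ => eq_refl)).
  - intros x; ring.
Qed.

Lemma bern_le (m : nat) (u : R) (f g : nat -> R) :
  0 <= u <= 1 ->
  forall k, (forall j, (k <= j <= k + m)%nat -> f j <= g j) ->
  bern m u f k <= bern m u g k.
Proof.
  intros Hu; induction m as [|m IH]; intros k Hfg; simpl.
  - apply Hfg; lia.
  - apply Rplus_le_compat; apply Rmult_le_compat_l; try lra;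
      apply IH; intros j Hj; apply Hfg; lia.
Qed.

Lemma bern_affine (m : nat) (u a b : R) (f : nat -> R) (k : nat) :
  bern m u (fun j => a + b * f j) k = a + b * bern m u f k.
Proof.
  revert k; induction m as [|m IH]; intros k; simpl; [easy|].
  rewrite !IH; ring.
Qed.

(** Squared bias plus variance of the shifted binomial variable. *)
Lemma bern_square (m : nat) (u s : R) (k : nat) :
  bern m u (fun j => (INR j - s) ^ 2) k =
  (INR k + INR m * u - s) ^ 2 + INR m * (u * (1 - u)).
Proof.
  revert k; induction m as [|m IH]; intros k.
  - simpl; ring.
  - change (bern (S m) u (fun j => (INR j - s) ^ 2) k) with
      (u * bern m u (fun j => (INR j - s) ^ 2) (S k) +
       (1 - u) * bern m u (fun j => (INR j - s) ^ 2) k).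
    rewrite !IH, !S_INR; ring.
Qed.

(** Bernstein's argument through the variance: averaging the quadratic majorant costs at most
    [K * u * (1 - u) / m]. As [c] and [eps] are arbitrary, the lemma also gives sup bounds ([K = 0])
    and can be nested for two variables. *)
Lemma bern_approx (m : nat) (u c eps K : R) (f : nat -> R) :
  (0 < m)%nat -> 0 <= u <= 1 -> 0 <= K ->
  (forall j, (j <= m)%nat -> Rabs (f j - c) <= eps + K * (INR j / INR m - u) ^ 2) ->
  Rabs (bern m u f 0 - c) <= eps + K / (4 * INR m).
Proof.
  intros Hm Hu HK Hf.
  assert (Hm' : 0 < INR m) by (apply lt_0_INR; lia).
  assert (Hvar : bern m u (fun j => (INR j - INR m * u) ^ 2) 0 <= INR m / 4).
  { rewrite bern_square; simpl INR.
    assert (u * (1 - u) <= / 4) by (pose proof (pow2_ge_0 (u - / 2)); lra).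
    replace ((0 + INR m * u - INR m * u) ^ 2) with 0 by ring. nra. }
  (* The sign [s] covers both halves of the absolute value. *)
  assert (Hb : forall s, s = 1 \/ s = -1 ->
    s * (bern m u f 0 - c) <= eps + K / (4 * INR m)).
  { intros s Hs.
    replace (s * (bern m u f 0 - c)) with (bern m u (fun j => (- s * c) + s * f j) 0)
      by (rewrite bern_affine; ring).
    apply Rle_trans with
      (bern m u (fun j => eps + K / INR m ^ 2 * (INR j - INR m * u) ^ 2) 0).
    - apply bern_le; [easy|]; intros j Hj; cbv beta.
      specialize (Hf j ltac:(lia)).
      replace (K / INR m ^ 2 * (INR j - INR m * u) ^ 2)
        with (K * (INR j / INR m - u) ^ 2) by (field; lra).
      apply Rabs_le_between in Hf; destruct Hs; subst s; lra.
    - rewrite (bern_affine m u eps (K / INR m ^ 2) (fun j => (INR j - INR m * u) ^ 2)).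
      apply Rplus_le_compat_l.
      replace (K / (4 * INR m)) with (K / INR m ^ 2 * (INR m / 4)) by (field; lra).
      apply Rmult_le_compat_l; [|easy].
      apply Rdiv_le_0_compat; [easy|]; apply pow_lt; easy. }
  apply Rabs_le; split.
  - pose proof (Hb (-1) ltac:(tauto)); lra.
  - pose proof (Hb 1 ltac:(tauto)); lra.
Qed.

Lemma archimed_div (K eps : R) :
  0 < eps -> exists m, (0 < m)%nat /\ K / INR m <= eps.
Proof.
  intros Heps.
  destruct (INR_unbounded (Rabs K / eps)) as [m Hm].
  assert (0 <= Rabs K / eps) by (apply Rdiv_le_0_compat; [apply Rabs_pos|easy]).
  exists m; split.
  - apply INR_lt; simpl; lra.
  - apply Rle_div_l; [lra|].
    apply Rlt_div_l in Hm; [|easy].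
    pose proof (Rle_abs K); lra.
Qed.

(** * Continuous functions and their time averages *)

Definition cont (f : R -> R) : Prop := forall x, continuous f x.

Lemma cont_ex_RInt f a b : cont f -> ex_RInt f a b.
Proof. intros Hf; apply (ex_RInt_continuous (V := R_CompleteNormedModule)); intros z _; apply Hf. Qed.

Lemma cont_const c : cont (fun _ => c).
Proof. intros x; apply continuous_const. Qed.

Lemma cont_id : cont (fun x => x).
Proof. intros x; apply continuous_id. Qed.

Lemma cont_plus f g : cont f -> cont g -> cont (fun x => f x + g x).
Proof. intros Hf Hg x; exact (continuous_plus f g x (Hf x) (Hg x)). Qed.

Lemma cont_mult f g : cont f -> cont g -> cont (fun x => f x * g x).
Proof. intros Hf Hg x; exact (continuous_mult f g x (Hf x) (Hg x)). Qed.

Lemma cont_comp f g : cont f -> cont g -> cont (fun x => g (f x)).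
Proof. intros Hf Hg x; exact (continuous_comp f g x (Hf x) (Hg (f x))). Qed.

Lemma cont_ext f g : (forall x, g x = f x) -> cont f -> cont g.
Proof.
  intros Hfg Hf x; apply (continuous_ext f); [intros y; symmetry; apply Hfg|apply Hf].
Qed.

Lemma cont_cos : cont cos.
Proof. intros x; apply continuous_cos. Qed.

Lemma cont_pow n : cont (fun x => x ^ n).
Proof.
  induction n as [|n IH]; [exact (cont_const 1)|].
  exact (cont_mult _ _ cont_id IH).
Qed.

Lemma cont_of_derive f f' : (forall x, is_derive f x (f' x)) -> cont f.
Proof.
  intros Hf x; apply (ex_derive_continuous f x); exists (f' x); apply Hf.
Qed.

(** Continuity is bundled in because [RInt] is total: its values obey linearity and monotonicity
    only for integrable functions. *)
Definition has_mean (f : R -> R) (mu : R) : Prop := cont f /\ time_avg f mu.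

Lemma time_avg_spec f mu :
  time_avg f mu <->
  forall eps, 0 < eps ->
    exists T0, 0 < T0 /\ forall T, T0 < T -> Rabs (RInt f 0 T / T - mu) < eps.
Proof.
  unfold time_avg; rewrite filterlim_locally; split.
  - intros H eps Heps; destruct (H (mkposreal eps Heps)) as [M HM].
    (* The maximum with 1 keeps the threshold positive, so that later divisions by [T] are
       legitimate. *)
    exists (Rmax M 1); split; [apply Rlt_le_trans with 1; [lra|apply Rmax_r]|].
    intros T HT; apply (HM T); apply Rle_lt_trans with (2 := HT); apply Rmax_l.
  - intros H eps; destruct (H eps (cond_pos eps)) as [T0 [_ HT]].
    exists T0; exact HT.
Qed.

Lemma has_mean_le f g mu nu :
  has_mean f mu -> has_mean g nu -> (forall t, f t <= g t) -> mu <= nu.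
Proof.
  intros [Cf Hf] [Cg Hg] Hle; rewrite time_avg_spec in Hf, Hg.
  apply le_epsilon; intros eps Heps.
  destruct (Hf (eps / 2) ltac:(lra)) as (T1 & HT1 & H1).
  destruct (Hg (eps / 2) ltac:(lra)) as (T2 & HT2 & H2).
  set (T := T1 + T2).
  specialize (H1 T ltac:(unfold T; lra)); specialize (H2 T ltac:(unfold T; lra)).
  assert (HT : 0 < T) by (unfold T; lra).
  assert (RInt f 0 T / T <= RInt g 0 T / T).
  { apply Rmult_le_compat_r; [apply Rlt_le, Rinv_0_lt_compat, HT|].
    apply RInt_le; [lra|now apply cont_ex_RInt|now apply cont_ex_RInt|].
    intros x _; apply Hle. }
  apply Rabs_def2 in H1; apply Rabs_def2 in H2; lra.
Qed.

Lemma has_mean_unique f mu nu : has_mean f mu -> has_mean f nu -> mu = nu.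
Proof.
  intros H1 H2; apply Rle_antisym; eapply has_mean_le; try eassumption;
    intros; apply Rle_refl.
Qed.

Lemma has_mean_ext f g mu :
  (forall t, g t = f t) -> has_mean f mu -> has_mean g mu.
Proof.
  intros Hfg [Cf Hf]; split; [now apply (cont_ext f)|].
  rewrite time_avg_spec in *; intros eps Heps.
  destruct (Hf eps Heps) as (T0 & HT0 & H); exists T0; split; [easy|].
  intros T HT; rewrite (RInt_ext g f); [now apply H|]; intros x _; apply Hfg.
Qed.

Lemma has_mean_plus f g mu nu :
  has_mean f mu -> has_mean g nu -> has_mean (fun t => f t + g t) (mu + nu).
Proof.
  intros [Cf Hf] [Cg Hg]; split; [now apply cont_plus|].
  rewrite time_avg_spec in *; intros eps Heps.
  destruct (Hf (eps / 2) ltac:(lra)) as (T1 & HT1 & H1).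
  destruct (Hg (eps / 2) ltac:(lra)) as (T2 & HT2 & H2).
  exists (T1 + T2); split; [lra|]; intros T HT.
  specialize (H1 T ltac:(lra)); specialize (H2 T ltac:(lra)).
  assert (E : RInt (fun t => f t + g t) 0 T = RInt f 0 T + RInt g 0 T)
    by (apply (RInt_plus f g); now apply cont_ex_RInt).
  rewrite E.
  apply Rabs_def2 in H1; apply Rabs_def2 in H2; apply Rabs_def1; lra.
Qed.

Lemma has_mean_scal c f mu : has_mean f mu -> has_mean (fun t => c * f t) (c * mu).
Proof.
  intros [Cf Hf]; split; [apply cont_mult; [apply cont_const|easy]|].
  rewrite time_avg_spec in *; intros eps Heps.
  assert (Hc : 0 < Rabs c + 1) by (pose proof (Rabs_pos c); lra).
  destruct (Hf (eps / (Rabs c + 1)) ltac:(now apply Rdiv_lt_0_compat)) as (T0 & HT0 & H).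
  exists T0; split; [easy|]; intros T HT; specialize (H T HT).
  assert (E : RInt (fun t => c * f t) 0 T = c * RInt f 0 T)
    by (apply (RInt_scal f); now apply cont_ex_RInt).
  rewrite E; replace (c * RInt f 0 T / T - c * mu) with (c * (RInt f 0 T / T - mu)) by (unfold Rdiv; ring).
  rewrite Rabs_mult.
  apply Rlt_div_r in H; [|easy].
  pose proof (Rabs_pos (RInt f 0 T / T - mu)); pose proof (Rabs_pos c); nra.
Qed.

Lemma has_mean_const c : has_mean (fun _ => c) c.
Proof.
  split; [apply cont_const|]; rewrite time_avg_spec; intros eps Heps.
  exists 1; split; [lra|]; intros T HT.
  rewrite RInt_const; unfold scal; simpl; unfold mult; simpl.
  replace ((T - 0) * c / T - c) with 0 by (field; lra).
  rewrite Rabs_R0; easy.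
Qed.

Lemma cont_cos_affine lam phi : cont (fun t => cos (lam * t + phi)).
Proof.
  apply (cont_comp (fun t => lam * t + phi) cos); [|apply cont_cos].
  apply cont_plus; [apply cont_mult; [apply cont_const|apply cont_id]|apply cont_const].
Qed.

(** The average over [0, T] is (F T - F 0) / T, which vanishes in the limit when the primitive is
    bounded. *)
Lemma has_mean_derive f F M :
  cont f -> (forall t, is_derive F t (f t)) -> (forall t, Rabs (F t - F 0) <= M) ->
  has_mean f 0.
Proof.
  intros Cf HF HM; split; [easy|]; rewrite time_avg_spec; intros eps Heps.
  assert (0 <= M) by (eapply Rle_trans; [apply Rabs_pos|apply (HM 0)]).
  exists ((M + 1) / eps); split; [apply Rdiv_lt_0_compat; lra|]; intros T HT.
  assert (HT0 : 0 < T).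
  { apply Rlt_trans with (2 := HT); apply Rdiv_lt_0_compat; lra. }
  assert (E : RInt f 0 T = F T - F 0).
  { apply is_RInt_unique, (is_RInt_derive F f); intros x _; [apply HF|apply Cf]. }
  rewrite E, Rminus_0_r; unfold Rdiv; rewrite Rabs_mult, Rabs_inv, (Rabs_right T) by lra.
  apply Rlt_div_l; [easy|].
  apply Rlt_div_l in HT; [|easy].
  pose proof (HM T); lra.
Qed.

Lemma has_mean_cos lam phi : lam <> 0 -> has_mean (fun t => cos (lam * t + phi)) 0.
Proof.
  intros Hl; apply (has_mean_derive _ (fun t => sin (lam * t + phi) / lam) (2 / Rabs lam)).
  - apply cont_cos_affine.
  - intros t; auto_derive; [easy|]; field; easy.
  - intros t.
    replace (sin (lam * t + phi) / lam - sin (lam * 0 + phi) / lam)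
      with ((sin (lam * t + phi) - sin (lam * 0 + phi)) / lam) by (field; easy).
    unfold Rdiv; rewrite Rabs_mult, Rabs_inv.
    apply Rmult_le_compat_r; [apply Rlt_le, Rinv_0_lt_compat, Rabs_pos_lt, Hl|].
    pose proof (SIN_bound (lam * t + phi)); pose proof (SIN_bound (lam * 0 + phi)).
    apply Rabs_le; lra.
Qed.

(** The bound [b] may vary with time: the approximation error on the plane grows quadratically, and
    only its mean is controlled. *)
Lemma has_mean_dist_le f g b mu nu beta :
  has_mean f mu -> has_mean g nu -> has_mean b beta ->
  (forall t, Rabs (f t - g t) <= b t) -> Rabs (mu - nu) <= beta.
Proof.
  intros Hf Hg Hb H; apply Rabs_le; split.
  - enough (nu <= mu + beta) by lra.
    apply (has_mean_le g (fun t => f t + b t)); [easy|now apply has_mean_plus|].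
    intros t; specialize (H t); apply Rabs_le_between in H; lra.
  - enough (mu <= nu + beta) by lra.
    apply (has_mean_le f (fun t => g t + b t)); [easy|now apply has_mean_plus|].
    intros t; specialize (H t); apply Rabs_le_between in H; lra.
Qed.

Lemma has_mean_close f g mu nu eps :
  has_mean f mu -> has_mean g nu -> (forall t, Rabs (f t - g t) <= eps) ->
  Rabs (mu - nu) <= eps.
Proof.
  intros Hf Hg H; exact (has_mean_dist_le f g _ mu nu eps Hf Hg (has_mean_const eps) H).
Qed.

(** Cauchy criterion for the averages. For each tolerance one approximant serves all large [T], so
    the means of different approximants are never compared. *)
Lemma ex_mean_uniform_limit f :
  cont f ->
  (forall eps, 0 < eps -> exists g mu, has_mean g mu /\ forall t, Rabs (f t - g t) <= eps) ->
  exists mu, has_mean f mu.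
Proof.
  intros Cf H.
  destruct (proj1 (filterlim_locally_cauchy (F := Rbar_locally p_infty)
    (fun T => RInt f 0 T / T))) as [mu Hmu].
  2: now exists mu; split.
  intros eps.
  (* One sixth for the uniform error and one sixth for the approximant's own convergence; two times
     [T] then differ by less than 2 eps / 3. *)
  destruct (H (eps / 6)) as (g & mu & [Cg Hg] & Hfg);
    [apply Rdiv_lt_0_compat; [apply cond_pos|lra]|].
  rewrite time_avg_spec in Hg.
  destruct (Hg (eps / 6)) as (T0 & HT0 & HT);
    [apply Rdiv_lt_0_compat; [apply cond_pos|lra]|].
  exists (fun T => T0 < T); split; [exists T0; tauto|].
  assert (Key : forall T, T0 < T -> Rabs (RInt f 0 T / T - mu) < eps / 3).
  { intros T HTT; specialize (HT T HTT).
    assert (E : RInt (fun t => f t - g t) 0 T = RInt f 0 T - RInt g 0 T)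
      by (apply (RInt_minus f g); now apply cont_ex_RInt).
    assert (B : Rabs (RInt (fun t => f t - g t) 0 T) <= (T - 0) * (eps / 6)).
    { apply abs_RInt_le_const; [lra| |intros; apply Hfg].
      apply (ex_RInt_minus f g); now apply cont_ex_RInt. }
    replace (RInt f 0 T / T - mu) with
      (RInt (fun t => f t - g t) 0 T / T + (RInt g 0 T / T - mu))
      by (rewrite E; field; lra).
    apply Rle_lt_trans with (1 := Rabs_triang _ _).
    assert (Rabs (RInt (fun t => f t - g t) 0 T / T) <= eps / 6).
    { unfold Rdiv at 1; rewrite Rabs_mult, Rabs_inv, (Rabs_right T) by lra.
      apply Rle_div_l; lra. }
    lra. }
  intros u v Hu Hv; specialize (Key u Hu) as K1; specialize (Key v Hv) as K2.
  change (Rabs (RInt f 0 v / v - RInt f 0 u / u) < eps).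
  apply Rabs_def2 in K1; apply Rabs_def2 in K2; apply Rabs_def1; lra.
Qed.

Lemma RInt_shift_R f s T : cont f ->
  RInt (fun t => f (t + s)) 0 T = RInt f 0 T - RInt f 0 s + RInt f T (T + s).
Proof.
  intros Cf.
  assert (E : RInt (fun t => f (t + s)) 0 T = RInt f s (T + s)).
  { pose proof (RInt_comp_lin (V := R_CompleteNormedModule) f 1 s 0 T
      (cont_ex_RInt f _ _ Cf)) as H.
    rewrite Rmult_0_r, Rplus_0_l, Rmult_1_l in H; rewrite <- H.
    apply RInt_ext; intros x _; rewrite <- (Rmult_1_l x) at 1.
    symmetry; exact (Rmult_1_l (f (1 * x + s))). }
  rewrite E.
  pose proof (RInt_Chasles f 0 s (T + s) (cont_ex_RInt f _ _ Cf) (cont_ex_RInt f _ _ Cf)) as H1.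
  pose proof (RInt_Chasles f 0 T (T + s) (cont_ex_RInt f _ _ Cf) (cont_ex_RInt f _ _ Cf)) as H2.
  unfold plus in H1, H2; simpl in H1, H2; lra.
Qed.

Lemma abs_RInt_bound f M a b :
  cont f -> (forall t, Rabs (f t) <= M) -> Rabs (RInt f a b) <= Rabs (b - a) * M.
Proof.
  intros Cf HM; destruct (Rle_dec a b) as [Hab|Hab].
  - rewrite (Rabs_right (b - a)) by lra.
    apply abs_RInt_le_const; [easy|now apply cont_ex_RInt|intros; apply HM].
  - rewrite <- opp_RInt_swap by now apply cont_ex_RInt.
    change (Rabs (- RInt f b a) <= Rabs (b - a) * M).
    rewrite Rabs_Ropp, Rabs_minus_sym, (Rabs_right (a - b)) by lra.
    apply abs_RInt_le_const; [lra|now apply cont_ex_RInt|intros; apply HM].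
Qed.

(** The windows [0, T] and [s, T + s] differ by two pieces of length |s|, negligible after division
    by [T]. It serves to exploit the half-period antisymmetry of a sine mean. *)
Lemma has_mean_shift f mu s M :
  (forall t, Rabs (f t) <= M) -> has_mean f mu -> has_mean (fun t => f (t + s)) mu.
Proof.
  intros HM [Cf Hf]; split.
  { apply (cont_comp (fun t => t + s) f); [|easy].
    apply cont_plus; [apply cont_id|apply cont_const]. }
  rewrite time_avg_spec in *; intros eps Heps.
  destruct (Hf (eps / 2) ltac:(lra)) as (T0 & HT0 & H).
  pose proof (abs_RInt_bound f M 0 s Cf HM) as B1.
  assert (0 <= Rabs s * M).
  { apply Rmult_le_pos; [apply Rabs_pos|].
    eapply Rle_trans; [apply Rabs_pos|apply (HM 0)]. }
  (* The boundary pieces total at most 2 |s| M, which this makes smaller than T eps / 2. *)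
  exists (T0 + 4 * (Rabs s * M) / eps); split.
  { assert (0 <= 4 * (Rabs s * M) / eps) by (apply Rdiv_le_0_compat; lra); lra. }
  intros T HT.
  assert (0 <= 4 * (Rabs s * M) / eps) by (apply Rdiv_le_0_compat; lra).
  specialize (H T ltac:(lra)).
  pose proof (abs_RInt_bound f M T (T + s) Cf HM) as B2.
  replace (T + s - T) with s in B2 by ring; rewrite Rminus_0_r in B1.
  assert (B3 : 4 * (Rabs s * M) < eps * T).
  { assert (B : 4 * (Rabs s * M) / eps < T) by lra.
    apply Rlt_div_l in B; lra. }
  rewrite RInt_shift_R by easy.
  replace ((RInt f 0 T - RInt f 0 s + RInt f T (T + s)) / T - mu) with
    ((RInt f 0 T / T - mu) + (RInt f T (T + s) - RInt f 0 s) / T) by (field; lra).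
  apply Rle_lt_trans with (1 := Rabs_triang _ _).
  assert (Rabs ((RInt f T (T + s) - RInt f 0 s) / T) < eps / 2).
  { unfold Rdiv at 1; rewrite Rabs_mult, Rabs_inv, (Rabs_right T) by lra.
    apply Rlt_div_l; [lra|].
    apply Rabs_le_between in B1; apply Rabs_le_between in B2.
    apply Rabs_def1; lra. }
  lra.
Qed.

(** * Almost periodic functions *)

Definition freqs (G : R -> Prop) (l : R -> R) : Prop :=
  exists lam, G lam /\ forall t, l t = lam * t.

Definition subgroup (G : R -> Prop) : Prop :=
  G 0 /\ (forall a b, G a -> G b -> G (a + b)) /\
  (forall a b, G a -> G b -> G (a - b)).

Lemma phase_group_freqs G : subgroup G -> phase_group (freqs G).
Proof.
  intros (H0 & Hadd & Hsub); split; [|split].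
  - exists 0; split; [easy|intros; ring].
  - intros k l (a & Ha & Ea) (b & Hb & Eb); exists (a + b); split; [now apply Hadd|].
    intros t; rewrite Ea, Eb; ring.
  - intros k l (a & Ha & Ea) (b & Hb & Eb); exists (a - b); split; [now apply Hsub|].
    intros t; rewrite Ea, Eb; ring.
Qed.

Lemma has_mean_cos_freq lam phi :
  exists mu, has_mean (fun t => cos (lam * t + phi)) mu.
Proof.
  destruct (Req_dec lam 0) as [->|Hl]; [|exists 0; now apply has_mean_cos].
  exists (cos phi); apply (has_mean_ext (fun _ => cos phi)); [|apply has_mean_const].
  intros t; f_equal; ring.
Qed.

Lemma trig_ex_mean G f : trig (freqs G) f -> exists mu, has_mean f mu.
Proof.
  intros Hf; induction Hf as [l phi f (lam & _ & El) Ef|c f1 f _ [mu IH] Ef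
    |f1 f2 f _ [mu IH1] _ [nu IH2] Ef].
  - destruct (has_mean_cos_freq lam phi) as [mu Hmu]; exists mu.
    eapply has_mean_ext; [|exact Hmu]; intros t; cbv beta; now rewrite Ef, El.
  - exists (c * mu); eapply has_mean_ext; [exact Ef|now apply has_mean_scal].
  - exists (mu + nu); eapply has_mean_ext; [exact Ef|now apply has_mean_plus].
Qed.

Lemma trig_bounded {X : Type} (F : (X -> R) -> Prop) f :
  trig F f -> exists M, forall x, Rabs (f x) <= M.
Proof.
  intros Hf; induction Hf as [l phi f _ Ef|c f1 f _ [M IH] Ef
    |f1 f2 f _ [M IH1] _ [N IH2] Ef].
  - exists 1; intros x; rewrite Ef; apply Rabs_le; apply COS_bound.
  - exists (Rabs c * M); intros x; rewrite Ef, Rabs_mult.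
    apply Rmult_le_compat_l; [apply Rabs_pos|easy].
  - exists (M + N); intros x; rewrite Ef.
    apply Rle_trans with (1 := Rabs_triang _ _); now apply Rplus_le_compat.
Qed.

Lemma trig_cont G f : trig (freqs G) f -> cont f.
Proof. intros Hf; destruct (trig_ex_mean G f Hf) as [mu [Cf _]]; exact Cf. Qed.

(** Orthogonality of characters: for a nonzero [lam] in [G] and [kap] in [H], neither [lam + kap]
    nor [lam - kap] can vanish, since [lam] would then lie in both sets. The general case follows by
    bilinearity. *)
Lemma trig_mean_mult G H f g :
  subgroup H -> (forall a, G a -> H a -> a = 0) ->
  trig (freqs G) f -> trig (freqs H) g ->
  exists mu nu, has_mean f mu /\ has_mean g nu /\
    has_mean (fun t => f t * g t) (mu * nu).
Proof.
  intros HH HGH Hf Hg.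
  induction Hf as [l phi f (lam & Hlam & El) Ef|c f1 f _ IH Ef|f1 f2 f _ IH1 _ IH2 Ef].
  - induction Hg as [k psi g (kap & Hkap & Ek) Eg|c g1 g _ IH Eg|g1 g2 g _ IH1 _ IH2 Eg].
    + assert (Ef' : forall t, f t = cos (lam * t + phi)) by (intros; now rewrite Ef, El).
      assert (Eg' : forall t, g t = cos (kap * t + psi)) by (intros; now rewrite Eg, Ek).
      (* At frequency zero the first factor is the constant [cos phi], and orthogonality is not at
         stake. *)
      destruct (Req_dec lam 0) as [->|Hl].
      { destruct (has_mean_cos_freq kap psi) as [nu Hnu].
        exists (cos phi), nu; split; [|split].
        - apply (has_mean_ext (fun _ => cos phi)); [|apply has_mean_const].
          intros t; rewrite Ef'; f_equal; ring.
        - now apply (has_mean_ext (fun t => cos (kap * t + psi))).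
        - apply (has_mean_ext (fun t => cos phi * cos (kap * t + psi))).
          + intros t; rewrite Ef', Eg'; f_equal; f_equal; ring.
          + now apply has_mean_scal. }
      destruct (has_mean_cos_freq kap psi) as [nu Hnu].
      exists 0, nu; split; [|split].
      * apply (has_mean_ext (fun t => cos (lam * t + phi))); [easy|now apply has_mean_cos].
      * now apply (has_mean_ext (fun t => cos (kap * t + psi))).
      * destruct HH as (H0 & Hadd & Hsub).
        assert (Hp : lam + kap <> 0).
        { intros E; apply Hl, HGH; [easy|].
          replace lam with (0 - kap) by lra; now apply Hsub. }
        assert (Hm : lam - kap <> 0).
        { intros E; apply Hl, HGH; [easy|]; now replace lam with kap by lra. }
        replace (0 * nu) with (/ 2 * 0 + / 2 * 0) by ring.
        apply (has_mean_ext (fun t => / 2 * cos ((lam + kap) * t + (phi + psi))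
                               + / 2 * cos ((lam - kap) * t + (phi - psi)))).
        { intros t; rewrite Ef', Eg'.
          replace ((lam + kap) * t + (phi + psi))
            with ((lam * t + phi) + (kap * t + psi)) by ring.
          replace ((lam - kap) * t + (phi - psi))
            with ((lam * t + phi) - (kap * t + psi)) by ring.
          generalize (lam * t + phi) (kap * t + psi); intros a b.
          rewrite cos_plus, cos_minus; field. }
        apply has_mean_plus; apply has_mean_scal; now apply has_mean_cos.
    + destruct IH as (mu & nu & H1 & H2 & H3); exists mu, (c * nu); split; [easy|split].
      * apply (has_mean_ext (fun t => c * g1 t)); [easy|now apply has_mean_scal].
      * replace (mu * (c * nu)) with (c * (mu * nu)) by ring.
        apply (has_mean_ext (fun t => c * (f t * g1 t))); [|now apply has_mean_scal].
        intros t; rewrite Eg; ring.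
    + destruct IH1 as (mu & nu1 & H1 & H2 & H3).
      destruct IH2 as (mu2 & nu2 & K1 & K2 & K3).
      (* Each induction hypothesis supplies its own mean of [f]; uniqueness identifies them. *)
      rewrite (has_mean_unique f mu2 mu K1 H1) in K3.
      exists mu, (nu1 + nu2); split; [easy|split].
      * apply (has_mean_ext (fun t => g1 t + g2 t)); [easy|now apply has_mean_plus].
      * rewrite Rmult_plus_distr_l.
        apply (has_mean_ext (fun t => f t * g1 t + f t * g2 t)); [|now apply has_mean_plus].
        intros t; rewrite Eg; ring.
  - destruct IH as (mu & nu & H1 & H2 & H3); exists (c * mu), nu; split; [|split; [easy|]].
    * apply (has_mean_ext (fun t => c * f1 t)); [easy|now apply has_mean_scal].
    * replace (c * mu * nu) with (c * (mu * nu)) by ring.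
      apply (has_mean_ext (fun t => c * (f1 t * g t))); [|now apply has_mean_scal].
      intros t; rewrite Ef; ring.
  - destruct IH1 as (mu1 & nu & H1 & H2 & H3).
    destruct IH2 as (mu2 & nu2 & K1 & K2 & K3).
    rewrite (has_mean_unique g nu2 nu K2 H2) in K3.
    exists (mu1 + mu2), nu; split; [|split; [easy|]].
    * apply (has_mean_ext (fun t => f1 t + f2 t)); [easy|now apply has_mean_plus].
    * rewrite Rmult_plus_distr_r.
      apply (has_mean_ext (fun t => f1 t * g t + f2 t * g t)); [|now apply has_mean_plus].
      intros t; rewrite Ef; ring.
Qed.

(** Bohr almost periodicity with spectrum in [G], taken in the form of Bohr's approximation theorem,
    from which means and products are immediate. *)
Definition almost_periodic (G : R -> Prop) (f : R -> R) : Prop :=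
  cont f /\
  forall eps, 0 < eps ->
    exists p, trig (freqs G) p /\ forall t, Rabs (f t - p t) <= eps.

Lemma ap_trig G f : trig (freqs G) f -> almost_periodic G f.
Proof.
  intros Hf; split; [now apply (trig_cont G)|]; intros eps Heps; exists f; split; [easy|].
  intros t; rewrite Rminus_diag, Rabs_R0; lra.
Qed.

Lemma ap_incl (G H : R -> Prop) f :
  (forall a, G a -> H a) -> almost_periodic G f -> almost_periodic H f.
Proof.
  intros HGH [Cf Hf]; split; [easy|]; intros eps Heps.
  destruct (Hf eps Heps) as (p & Hp & B); exists p; split; [|easy].
  apply (trig_incl (freqs G)); [|easy].
  intros l (lam & Hlam & El); exists lam; split; [now apply HGH|easy].
Qed.

Lemma ap_ext G f g :
  (forall t, g t = f t) -> almost_periodic G f -> almost_periodic G g.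
Proof.
  intros E [Cf Hf]; split; [now apply (cont_ext f)|]; intros eps Heps.
  destruct (Hf eps Heps) as (p & Hp & B); exists p; split; [easy|].
  intros t; rewrite E; apply B.
Qed.

Lemma ap_scal G c f : almost_periodic G f -> almost_periodic G (fun t => c * f t).
Proof.
  intros [Cf Hf]; split; [apply cont_mult; [apply cont_const|easy]|]; intros eps Heps.
  assert (Hc : 0 < Rabs c + 1) by (pose proof (Rabs_pos c); lra).
  destruct (Hf (eps / (Rabs c + 1)) ltac:(now apply Rdiv_lt_0_compat)) as (p & Hp & B).
  exists (fun t => c * p t); split; [now apply (trig_scal _ c p)|].
  intros t; rewrite <- Rmult_minus_distr_l, Rabs_mult.
  specialize (B t); apply Rle_div_r in B; [|easy].
  pose proof (Rabs_pos (f t - p t)); nra.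
Qed.

Lemma ap_plus G f g :
  almost_periodic G f -> almost_periodic G g -> almost_periodic G (fun t => f t + g t).
Proof.
  intros [Cf Hf] [Cg Hg]; split; [now apply cont_plus|]; intros eps Heps.
  destruct (Hf (eps / 2) ltac:(lra)) as (p & Hp & B1).
  destruct (Hg (eps / 2) ltac:(lra)) as (q & Hq & B2).
  exists (fun t => p t + q t); split; [now apply (trig_plus _ p q)|].
  intros t; specialize (B1 t); specialize (B2 t).
  apply Rabs_le_between in B1; apply Rabs_le_between in B2; apply Rabs_le; lra.
Qed.

Lemma ap_ex_mean G f : almost_periodic G f -> exists mu, has_mean f mu.
Proof.
  intros [Cf Hf]; apply ex_mean_uniform_limit; [easy|]; intros eps Heps.
  destruct (Hf eps Heps) as (p & Hp & B); destruct (trig_ex_mean G p Hp) as [mu Hmu].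
  now exists p, mu.
Qed.

Lemma ap_bounded G f : almost_periodic G f -> exists M, forall t, Rabs (f t) <= M.
Proof.
  intros [_ Hf]; destruct (Hf 1 Rlt_0_1) as (p & Hp & B).
  destruct (trig_bounded _ p Hp) as [M HM]; exists (1 + M); intros t.
  replace (f t) with ((f t - p t) + p t) by ring.
  apply Rle_trans with (1 := Rabs_triang _ _); now apply Rplus_le_compat.
Qed.

Lemma Rabs_mult_close M eps a b p q :
  Rabs a <= M -> Rabs b <= M -> Rabs (a - p) <= eps -> Rabs (b - q) <= eps ->
  Rabs (a * b - p * q) <= eps * (2 * M + eps).
Proof.
  intros Ha Hb Hp Hq.
  replace (a * b - p * q) with ((a - p) * b + a * (b - q) - (a - p) * (b - q)) by ring.
  pose proof (Rabs_pos a); pose proof (Rabs_pos b).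
  pose proof (Rabs_pos (a - p)); pose proof (Rabs_pos (b - q)).
  apply Rle_trans with (1 := Rabs_triang _ _); rewrite Rabs_Ropp.
  apply Rle_trans with (Rabs ((a - p) * b) + Rabs (a * (b - q)) + Rabs ((a - p) * (b - q))).
  { apply Rplus_le_compat_r, Rabs_triang. }
  rewrite !Rabs_mult.
  assert (Rabs (a - p) * Rabs b <= eps * M) by (apply Rmult_le_compat; easy).
  assert (Rabs a * Rabs (b - q) <= M * eps) by (apply Rmult_le_compat; easy).
  assert (Rabs (a - p) * Rabs (b - q) <= eps * eps) by (apply Rmult_le_compat; easy).
  lra.
Qed.

(** Inverts the error bound of [Rabs_mult_close]. *)
Lemma small_factor M eps : 0 <= M -> 0 < eps ->
  exists del, 0 < del /\ del * (2 * M + del) <= eps.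
Proof.
  intros HM Heps.
  assert (H : 0 < eps / (2 * M + 1 + eps)) by (apply Rdiv_lt_0_compat; lra).
  exists (eps / (2 * M + 1 + eps)); split; [easy|].
  assert (E : eps / (2 * M + 1 + eps) * (2 * M + 1 + eps) = eps) by (field; lra).
  assert (eps / (2 * M + 1 + eps) <= eps).
  { apply Rle_div_l; nra. }
  nra.
Qed.

Lemma ap_mult G f g : subgroup G ->
  almost_periodic G f -> almost_periodic G g -> almost_periodic G (fun t => f t * g t).
Proof.
  intros HG Hf Hg.
  destruct (ap_bounded G f Hf) as [M1 HM1]; destruct (ap_bounded G g Hg) as [M2 HM2].
  destruct Hf as [Cf Hf]; destruct Hg as [Cg Hg].
  split; [now apply cont_mult|]; intros eps Heps.
  set (M := Rmax M1 M2).
  assert (HM : 0 <= M).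
  { apply Rle_trans with M1; [|apply Rmax_l].
    apply Rle_trans with (2 := HM1 0), Rabs_pos. }
  destruct (small_factor M eps HM Heps) as (del & Hdel & Hde).
  destruct (Hf del Hdel) as (p & Hp & B1); destruct (Hg del Hdel) as (q & Hq & B2).
  exists (fun t => p t * q t); split; [now apply trig_mult; [apply phase_group_freqs|..]|].
  intros t; apply Rle_trans with (2 := Hde); apply Rabs_mult_close; try easy.
  - apply Rle_trans with (1 := HM1 t), Rmax_l.
  - apply Rle_trans with (1 := HM2 t), Rmax_r.
Qed.

(* Kronecker's theorem in the form: functions whose frequencies lie in
   independent subgroups are statistically independent in the time average. *)
Lemma ap_mean_mult G H K f g mu nu :
  subgroup H -> subgroup K -> (forall a, G a -> H a -> a = 0) ->
  (forall a, G a -> K a) -> (forall a, H a -> K a) ->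
  almost_periodic G f -> almost_periodic H g -> has_mean f mu -> has_mean g nu ->
  has_mean (fun t => f t * g t) (mu * nu).
Proof.
  intros HH HK HGH GK HK' Hf Hg Mf Mg.
  destruct (ap_ex_mean K (fun t => f t * g t)) as [m Hm].
  { apply ap_mult; [easy|now apply (ap_incl G)|now apply (ap_incl H)]. }
  (* Existence of the mean comes from almost periodicity over [K]. Its value is found by comparing
     both [m] and [mu * nu] with the product of the means of two trigonometric approximants. *)
  enough (m = mu * nu) by now subst m.
  destruct (ap_bounded G f Hf) as [M1 HM1]; destruct (ap_bounded H g Hg) as [M2 HM2].
  set (M := Rmax M1 M2).
  assert (HM1' : forall t, Rabs (f t - 0) <= M).
  { intros t; rewrite Rminus_0_r; apply Rle_trans with (1 := HM1 t), Rmax_l. }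
  assert (HM2' : forall t, Rabs (g t - 0) <= M).
  { intros t; rewrite Rminus_0_r; apply Rle_trans with (1 := HM2 t), Rmax_r. }
  assert (HM : 0 <= M) by (apply Rle_trans with (2 := HM1' 0), Rabs_pos).
  assert (Bmu : Rabs mu <= M).
  { rewrite <- (Rminus_0_r mu); exact (has_mean_close f _ mu 0 M Mf (has_mean_const 0) HM1'). }
  assert (Bnu : Rabs nu <= M).
  { rewrite <- (Rminus_0_r nu); exact (has_mean_close g _ nu 0 M Mg (has_mean_const 0) HM2'). }
  apply Rminus_diag_uniq, Rabs_eq_0, Rle_antisym; [|apply Rabs_pos].
  apply le_epsilon; intros eps Heps; rewrite Rplus_0_l.
  destruct (small_factor M (eps / 2) HM ltac:(lra)) as (del & Hdel & Hde).
  destruct Hf as [Cf Hf]; destruct Hg as [Cg Hg].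
  destruct (Hf del Hdel) as (p & Hp & B1); destruct (Hg del Hdel) as (q & Hq & B2).
  destruct (trig_mean_mult G H p q HH HGH Hp Hq) as (mp & mq & Mp & Mq & Mpq).
  assert (D1 : Rabs (m - mp * mq) <= eps / 2).
  { apply (has_mean_close _ _ _ _ _ Hm Mpq); intros t.
    apply Rle_trans with (2 := Hde); apply Rabs_mult_close; try easy.
    - now rewrite <- (Rminus_0_r (f t)).
    - now rewrite <- (Rminus_0_r (g t)). }
  assert (D2 : Rabs (mu * nu - mp * mq) <= eps / 2).
  { apply Rle_trans with (2 := Hde); apply Rabs_mult_close; try easy.
    - now apply (has_mean_close f p).
    - now apply (has_mean_close g q). }
  apply Rabs_le_between in D1; apply Rabs_le_between in D2; apply Rabs_le; lra.
Qed.

(** * The mean of a single oscillator *)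

Lemma Rabs_cos_sub_le a b : Rabs (cos a - cos b) <= Rabs (a - b).
Proof.
  destruct (MVT_gen cos b a (fun x => - sin x)) as (c & _ & E).
  - intros x _; auto_derive; [easy|ring].
  - intros x _; apply continuity_cos.
  - rewrite E, Rabs_mult, Rabs_Ropp.
    rewrite <- (Rmult_1_l (Rabs (a - b))) at 2.
    apply Rmult_le_compat_r; [apply Rabs_pos|]; apply Rabs_le, SIN_bound.
Qed.

Definition multiples (e lam : R) : Prop := exists k : Z, lam = IZR k * e.

Lemma subgroup_multiples e : subgroup (multiples e).
Proof.
  split; [exists 0%Z; simpl; ring|split]; intros a b [k ->] [l ->].
  - exists (k + l)%Z; rewrite plus_IZR; ring.
  - exists (k - l)%Z; rewrite minus_IZR; ring.
Qed.

Lemma trig_cos_multiple e b : trig (freqs (multiples e)) (fun t => cos (t * e + b)).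
Proof.
  apply (trig_cos _ (fun t => t * e) b); [|easy].
  exists e; split; [exists 1%Z; simpl; ring|intros; ring].
Qed.

(** A Lipschitz function of [u t], which lies in [0, 1], is approximated by Bernstein polynomials in
    [u t]; these only involve multiples of the frequency [e]. *)
Lemma ap_cos_cos e b x phi :
  almost_periodic (multiples e) (fun t => cos (x * cos (t * e + b) + phi)).
Proof.
  set (u := fun t => (1 + cos (t * e + b)) / 2).
  set (f := fun j m => cos (x * (2 * (INR j / INR m) - 1) + phi)).
  pose proof (phase_group_freqs _ (subgroup_multiples e)) as PG.
  split.
  { apply (cont_ext (fun t => cos (x * cos (e * t + b) + phi))).
    - intros t; rewrite (Rmult_comm t); reflexivity.
    - apply (cont_comp (fun t => x * cos (e * t + b) + phi)); [|apply cont_cos].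
      apply cont_plus; [|apply cont_const].
      apply cont_mult; [apply cont_const|apply cont_cos_affine]. }
  intros eps Heps.
  (* Chosen so that [K * (eps / 2)] dominates [(2 * x) ^ 2]; the summand 1 keeps [K] positive at
     [x = 0]. *)
  set (K := 4 * (1 + x ^ 2) / (eps / 2)).
  assert (HK : 0 < K) by (apply Rdiv_lt_0_compat; nra).
  destruct (archimed_div (K / 4) (eps / 2) ltac:(lra)) as (m & Hm & HmK).
  exists (fun t => bern m (u t) (fun j => f j m) 0); split.
  - apply (trig_bern (freqs (multiples e)) u (fun _ j => f j m)); [easy| |].
    + apply (trig_plus _ (fun _ => / 2) (fun t => / 2 * cos (t * e + b))).
      * now apply trig_const.
      * apply (trig_scal _ (/ 2) (fun t => cos (t * e + b))); [apply trig_cos_multiple|easy].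
      * intros t; unfold u; field.
    + intros k; now apply trig_const.
  - intros t; rewrite Rabs_minus_sym.
    assert (Hm' : 0 < INR m) by (apply lt_0_INR; lia).
    apply Rle_trans with (eps / 2 + K / (4 * INR m)).
    2:{ replace (K / (4 * INR m)) with (K / 4 / INR m) by (field; lra). lra. }
    apply bern_approx; [easy| |lra|].
    + unfold u; pose proof (COS_bound (t * e + b)); lra.
    + intros j _; unfold f.
      apply Rle_trans with (1 := Rabs_cos_sub_le _ _).
      replace (x * (2 * (INR j / INR m) - 1) + phi - (x * cos (t * e + b) + phi))
        with (2 * x * (INR j / INR m - u t)) by (unfold u; field; lra).
      set (v := INR j / INR m - u t).
      (* AM-GM: [2 x v <= eps / 2 + 2 x^2 v^2 / eps]. *)
      assert (HKe : K * (eps / 2) = 4 * (1 + x ^ 2)) by (unfold K; field; lra).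
      assert (Hsq : (2 * x * v) ^ 2 <= K * v ^ 2 * (eps / 2)).
      { replace (K * v ^ 2 * (eps / 2)) with (K * (eps / 2) * v ^ 2) by ring.
        rewrite HKe; pose proof (pow2_ge_0 v); nra. }
      assert (HKv : 0 <= K * v ^ 2) by (apply Rmult_le_pos; [lra|apply pow2_ge_0]).
      apply Rsqr_incr_0_var; [|lra].
      unfold Rsqr; rewrite <- Rabs_mult, Rabs_right; [|apply Rle_ge, Rle_0_sqr].
      nra.
Qed.

Lemma cos_taylor_bounds u : -1 <= u <= 1 ->
  1 - u ^ 2 / 2 <= cos u <= 1 - u ^ 2 / 2 + u ^ 4 / 24.
Proof.
  intros Hu; destruct (pre_cos_bound u 0 ltac:(lra) ltac:(lra)) as [H1 H2].
  unfold cos_approx, cos_term in *; simpl in *; split; lra.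
Qed.

(** Since log (1 - x) = - x - x^2/2 - ..., the coefficient 1/4 here and 2 in the next lemma lie on
    either side of 1/2. Squaring exp (- x/2) >= 1 - x/2 produces the quadratic term to be traded
    against exp (- x^2/4). *)
Lemma exp_ge_quadratic x : 0 <= x <= 1 -> 1 - x <= exp (- x - x ^ 2 / 4).
Proof.
  intros Hx.
  pose proof (exp_ineq1_le (- x / 2)) as H1; pose proof (exp_ineq1_le (- (x ^ 2 / 4))) as H2.
  replace (- x - x ^ 2 / 4) with (- x / 2 + - x / 2 + - (x ^ 2 / 4)) by field.
  rewrite !exp_plus.
  set (a := exp (- x / 2)) in *; set (c := exp (- (x ^ 2 / 4))) in *.
  assert (Ha : 1 - x + x ^ 2 / 4 <= a * a) by nra.
  apply Rle_trans with ((1 - x + x ^ 2 / 4) * (1 - x ^ 2 / 4)).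
  - assert (0 <= x ^ 2 / 4 * (x - x ^ 2 / 4)) by (apply Rmult_le_pos; nra). nra.
  - apply Rmult_le_compat; nra.
Qed.

(** After inversion this is (1 + x + 2 x^2) (1 - x) = 1 + x^2 (1 - 2 x) >= 1. *)
Lemma exp_le_quadratic x : 0 <= x <= / 2 -> exp (- x - 2 * x ^ 2) <= 1 - x.
Proof.
  intros Hx.
  replace (- x - 2 * x ^ 2) with (- (x + 2 * x ^ 2)) by ring.
  rewrite exp_Ropp.
  pose proof (exp_ineq1_le (x + 2 * x ^ 2)) as H.
  assert (0 < 1 - x) by lra.
  rewrite <- (Rinv_inv (1 - x)).
  apply Rinv_le_contravar; [now apply Rinv_0_lt_compat|].
  apply Rle_trans with (2 := H).
  rewrite <- Rdiv_1_l; apply Rle_div_l; [easy|].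
  assert (0 <= x ^ 2 * (1 - 2 * x)) by (apply Rmult_le_pos; nra). nra.
Qed.

Lemma has_mean_cos_sq e b : e <> 0 -> has_mean (fun t => cos (t * e + b) ^ 2) (/ 2).
Proof.
  intros He.
  replace (/ 2) with (/ 2 + / 2 * 0) by ring.
  apply (has_mean_ext (fun t => / 2 + / 2 * cos (2 * e * t + 2 * b))).
  - intros t; replace (2 * e * t + 2 * b) with (2 * (t * e + b)) by ring.
    rewrite cos_2a_cos; field.
  - apply has_mean_plus; [apply has_mean_const|apply has_mean_scal, has_mean_cos; lra].
Qed.

Lemma has_mean_cos_pow4 e b : e <> 0 -> has_mean (fun t => cos (t * e + b) ^ 4) (3 / 8).
Proof.
  intros He.
  replace (3 / 8) with (3 / 8 + (/ 2 * 0 + / 8 * 0)) by field.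
  apply (has_mean_ext (fun t => 3 / 8 + (/ 2 * cos (2 * e * t + 2 * b)
                                         + / 8 * cos (4 * e * t + 4 * b)))).
  - intros t; replace (2 * e * t + 2 * b) with (2 * (t * e + b)) by ring.
    replace (4 * e * t + 4 * b) with (2 * (2 * (t * e + b))) by ring.
    rewrite (cos_2a_cos (2 * (t * e + b))), cos_2a_cos; field.
  - apply has_mean_plus; [apply has_mean_const|].
    apply has_mean_plus; apply has_mean_scal, has_mean_cos; lra.
Qed.

(* [nu] is the Bessel value [J_0(x)]. *)
Lemma has_mean_cos_cos e b x : e <> 0 ->
  exists nu,
    (forall phi, has_mean (fun t => cos (x * cos (t * e + b) + phi)) (nu * cos phi)) /\
    (Rabs x <= 1 ->
       exp (- x ^ 2 / 4 - x ^ 4 / 8) <= nu <= exp (- x ^ 2 / 4 - x ^ 4 / 128)).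
Proof.
  intros He.
  destruct (ap_ex_mean _ _ (ap_cos_cos e b x 0)) as [nu Hnu].
  destruct (ap_ex_mean _ _ (ap_cos_cos e b x (- (PI / 2)))) as [s Hs].
  (* [s] is the mean of sin (x cos theta), which changes sign under the half-period shift by
     [PI / e]. Hence only the cosine part survives, whatever the phase. *)
  assert (Hs0 : s = 0).
  { pose proof (has_mean_shift _ s (PI / e) 1 (fun t => proj2 (Rabs_le_between _ _)
      (COS_bound (x * cos (t * e + b) + - (PI / 2)))) Hs) as H1.
    pose proof (has_mean_scal (-1) _ _ Hs) as H2.
    enough (s = -1 * s) by lra.
    apply (has_mean_unique _ _ _ H1); eapply has_mean_ext; [|exact H2].
    intros t; cbv beta.
    replace ((t + PI / e) * e + b) with (t * e + b + PI) by (field; easy).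
    rewrite neg_cos.
    replace (x * - cos (t * e + b) + - (PI / 2)) with
      (- (x * cos (t * e + b) + - (PI / 2) + PI)) by field.
    rewrite cos_neg, neg_cos; ring. }
  subst s; exists nu; split.
  - intros phi.
    replace (nu * cos phi) with (cos phi * nu + - sin phi * 0) by ring.
    apply (has_mean_ext (fun t => cos phi * cos (x * cos (t * e + b) + 0)
      + - sin phi * cos (x * cos (t * e + b) + - (PI / 2)))).
    + intros t; generalize (x * cos (t * e + b)); intros a.
      rewrite Rplus_0_r, (cos_plus a phi), (cos_plus a (- (PI / 2))).
      rewrite cos_neg, sin_neg, cos_PI2, sin_PI2; ring.
    + apply has_mean_plus; now apply has_mean_scal.
  - intros Hx; apply Rabs_le_between in Hx.
    assert (Hc : forall t, -1 <= x * cos (t * e + b) <= 1).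
    { intros t; pose proof (COS_bound (t * e + b)); split; nra. }
    assert (B1 : 1 - x ^ 2 / 4 <= nu).
    { apply (has_mean_le (fun t => 1 + - (x ^ 2 / 2) * cos (t * e + b) ^ 2)
        (fun t => cos (x * cos (t * e + b) + 0))); [|easy|].
      - replace (1 - x ^ 2 / 4) with (1 + - (x ^ 2 / 2) * / 2) by field.
        apply has_mean_plus; [apply has_mean_const|apply has_mean_scal, has_mean_cos_sq, He].
      - intros t; rewrite Rplus_0_r.
        destruct (cos_taylor_bounds _ (Hc t)) as [H _].
        rewrite Rpow_mult_distr in H; lra. }
    (* The mean of the quartic Taylor bound is 1 - x^2/4 + x^4/64, a perfect square;
       [exp_ge_quadratic] at x^2/8, squared, then yields the coefficient 1/128. *)
    assert (B2 : nu <= (1 - x ^ 2 / 8) ^ 2).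
    { apply (has_mean_le (fun t => cos (x * cos (t * e + b) + 0))
        (fun t => 1 + (- (x ^ 2 / 2) * cos (t * e + b) ^ 2
                       + x ^ 4 / 24 * cos (t * e + b) ^ 4))); [easy| |].
      - replace ((1 - x ^ 2 / 8) ^ 2) with (1 + (- (x ^ 2 / 2) * / 2 + x ^ 4 / 24 * (3 / 8)))
          by field.
        apply has_mean_plus; [apply has_mean_const|apply has_mean_plus].
        + apply has_mean_scal, has_mean_cos_sq, He.
        + apply has_mean_scal, has_mean_cos_pow4, He.
      - intros t; rewrite Rplus_0_r.
        destruct (cos_taylor_bounds _ (Hc t)) as [_ H].
        rewrite !Rpow_mult_distr in H; lra. }
    assert (Hx2 : 0 <= x ^ 2 <= 1) by (split; [apply pow2_ge_0|nra]).
    split.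
    + apply Rle_trans with (2 := B1).
      replace (- x ^ 2 / 4 - x ^ 4 / 8) with (- (x ^ 2 / 4) - 2 * (x ^ 2 / 4) ^ 2) by field.
      apply exp_le_quadratic; lra.
    + apply Rle_trans with (1 := B2).
      pose proof (exp_ge_quadratic (x ^ 2 / 8) ltac:(lra)) as H.
      replace (- x ^ 2 / 4 - x ^ 4 / 128) with
        ((- (x ^ 2 / 8) - (x ^ 2 / 8) ^ 2 / 4) + (- (x ^ 2 / 8) - (x ^ 2 / 8) ^ 2 / 4)) by field.
      rewrite exp_plus.
      replace ((1 - x ^ 2 / 8) ^ 2) with ((1 - x ^ 2 / 8) * (1 - x ^ 2 / 8)) by ring.
      apply Rmult_le_compat; lra.
Qed.

(** * Sums of independent oscillations *)

Lemma sumR_S n f : sumR (S n) f = sumR n f + f n.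
Proof.
  unfold sumR; rewrite seq_S, map_app, fold_right_app; simpl.
  generalize (map f (seq 0 n)); intros l; induction l as [|a l IH]; simpl; [ring|].
  rewrite IH; ring.
Qed.

Lemma sumR_ext n f g :
  (forall j, (j < n)%nat -> f j = g j) -> sumR n f = sumR n g.
Proof.
  induction n as [|n IH]; intros H; [easy|]; rewrite !sumR_S.
  rewrite (H n) by lia; f_equal; apply IH; intros j Hj; apply H; lia.
Qed.

Lemma sumR_scal n c f : sumR n (fun j => c * f j) = c * sumR n f.
Proof.
  induction n as [|n IH]; [unfold sumR; simpl; ring|].
  rewrite !sumR_S, IH; ring.
Qed.

Lemma sumR_plus n f g : sumR n (fun j => f j + g j) = sumR n f + sumR n g.
Proof.
  induction n as [|n IH]; [unfold sumR; simpl; ring|].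
  rewrite !sumR_S, IH; ring.
Qed.

Lemma sumR_le n f g :
  (forall j, (j < n)%nat -> f j <= g j) -> sumR n f <= sumR n g.
Proof.
  induction n as [|n IH]; intros H; [apply Rle_refl|]; rewrite !sumR_S.
  apply Rplus_le_compat; [apply IH; intros j Hj|]; apply H; lia.
Qed.

Lemma sumR_nonneg n f : (forall j, (j < n)%nat -> 0 <= f j) -> 0 <= sumR n f.
Proof.
  intros H; replace 0 with (sumR n (fun _ => 0 * 0)) by (rewrite sumR_scal; ring).
  apply sumR_le; intros j Hj; rewrite Rmult_0_l; now apply H.
Qed.

Lemma sumR_term_le n f j :
  (forall i, (i < n)%nat -> 0 <= f i) -> (j < n)%nat -> f j <= sumR n f.
Proof.
  induction n as [|n IH]; intros H Hj; [lia|]; rewrite sumR_S.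
  assert (0 <= f n) by (apply H; lia).
  assert (0 <= sumR n f) by (apply sumR_nonneg; intros; apply H; lia).
  destruct (Nat.eq_dec j n) as [->|Hne]; [lra|].
  enough (f j <= sumR n f) by lra; apply IH; [intros; apply H|]; lia.
Qed.

(** * Frequency lattices of independent energies *)

Definition lattice (n : nat) (E : nat -> R) (lam : R) : Prop :=
  exists k : nat -> Z, lam = sumR n (fun j => IZR (k j) * E j).

Lemma subgroup_lattice n E : subgroup (lattice n E).
Proof.
  split; [|split].
  - exists (fun _ => 0%Z); rewrite sumR_scal; ring.
  - intros a b [k ->] [l ->]; exists (fun j => (k j + l j)%Z).
    rewrite <- sumR_plus; apply sumR_ext; intros j _; rewrite plus_IZR; ring.
  - intros a b [k ->] [l ->]; exists (fun j => (k j - l j)%Z).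
    transitivity (sumR n (fun j => IZR (k j) * E j)
      + sumR n (fun j => (-1) * (IZR (l j) * E j))).
    + rewrite sumR_scal; ring.
    + rewrite <- sumR_plus; apply sumR_ext; intros j _; rewrite minus_IZR; ring.
Qed.

Lemma lattice_S n E a : lattice n E a -> lattice (S n) E a.
Proof.
  (* The coefficient function is total and unconstrained at [n], so it must be reset to 0 there. *)
  intros [k ->]; exists (fun j => if Nat.eq_dec j n then 0%Z else k j).
  rewrite sumR_S; destruct (Nat.eq_dec n n) as [_|]; [|easy].
  rewrite Rmult_0_l, Rplus_0_r; apply sumR_ext; intros j Hj.
  destruct (Nat.eq_dec j n); [lia|easy].
Qed.

Lemma lattice_last n E a : multiples (E n) a -> lattice (S n) E a.
Proof.
  intros [k ->]; exists (fun j => if Nat.eq_dec j n then k else 0%Z).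
  rewrite sumR_S; destruct (Nat.eq_dec n n) as [_|]; [|easy].
  rewrite (sumR_ext n _ (fun j => 0 * E j)), sumR_scal; [ring|]; intros j Hj.
  destruct (Nat.eq_dec j n); [lia|easy].
Qed.

Lemma Q2R_inject_Z k : Q2R (inject_Z k) = IZR k.
Proof. unfold Q2R; simpl; field. Qed.

Lemma Q_lin_indep_Z n E (k : nat -> Z) :
  Q_lin_indep n E -> sumR n (fun j => IZR (k j) * E j) = 0 ->
  forall j, (j < n)%nat -> IZR (k j) = 0.
Proof.
  intros HE Hk j Hj; rewrite <- Q2R_inject_Z.
  apply (HE (fun j => inject_Z (k j))); [|easy].
  rewrite <- Hk; apply sumR_ext; intros i _; now rewrite Q2R_inject_Z.
Qed.

Lemma Q_lin_indep_S n E : Q_lin_indep (S n) E -> Q_lin_indep n E.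
Proof.
  intros HE c Hc j Hj.
  pose proof (HE (fun j => if Nat.eq_dec j n then 0%Q else c j)) as H.
  assert (Hs : sumR (S n) (fun j => Q2R (if Nat.eq_dec j n then 0%Q else c j) * E j) = 0).
  { rewrite sumR_S; destruct (Nat.eq_dec n n) as [_|]; [|easy].
    replace (Q2R 0) with 0 by (unfold Q2R; simpl; field).
    rewrite Rmult_0_l, Rplus_0_r, <- Hc; apply sumR_ext; intros i Hi.
    destruct (Nat.eq_dec i n); [lia|easy]. }
  specialize (H Hs j ltac:(lia)); cbv beta in H.
  destruct (Nat.eq_dec j n); [lia|easy].
Qed.

(** The disjointness of spectra that factorisation requires: equating the two expressions of [a] is
    a rational relation with coefficient [- l] at index [n]. *)
Lemma lattice_multiples n E a :
  Q_lin_indep (S n) E -> lattice n E a -> multiples (E n) a -> a = 0.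
Proof.
  intros HE [k Hk] [l Hl].
  assert (H : IZR (if Nat.eq_dec n n then - l else k n)%Z = 0).
  { apply (Q_lin_indep_Z (S n) E (fun j => if Nat.eq_dec j n then - l else k j)%Z HE); [|lia].
    rewrite sumR_S; destruct (Nat.eq_dec n n) as [_|]; [|easy].
    rewrite opp_IZR, (sumR_ext n _ (fun j => IZR (k j) * E j)); [lra|].
    intros j Hj; destruct (Nat.eq_dec j n); [lia|easy]. }
  destruct (Nat.eq_dec n n) as [_|]; [|easy].
  rewrite opp_IZR in H; rewrite Hl; replace (IZR l) with 0 by lra; ring.
Qed.

Lemma Q_lin_indep_neq_0 n E : Q_lin_indep (S n) E -> E n <> 0.
Proof.
  intros HE H0.
  assert (H : IZR (if Nat.eq_dec n n then 1 else 0)%Z = 0).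
  { apply (Q_lin_indep_Z (S n) E (fun j => if Nat.eq_dec j n then 1 else 0)%Z HE); [|lia].
    rewrite sumR_S, H0, (sumR_ext n _ (fun j => 0 * E j)), sumR_scal; [ring|].
    intros j Hj; destruct (Nat.eq_dec j n); [lia|easy]. }
  destruct (Nat.eq_dec n n); [lra|easy].
Qed.

(** The phase [b] is common to all terms: 0 gives the real part of [Yn], [PI / 2] the imaginary
    part. *)
Definition osc (n : nat) (E : nat -> R) (b : R) (x : nat -> R) (t : R) : R :=
  sumR n (fun j => x j * cos (t * E j + b)).

(** Oscillators are added one at a time, and [P] collects their Bessel factors. All phases are
    treated together because the addition formula for the new oscillator mixes [phi] with
    quarter-turn shifts. *)
Lemma osc_mean_cos n E b x :
  Q_lin_indep n E ->
  exists P,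
    (forall phi, almost_periodic (lattice n E) (fun t => cos (osc n E b x t + phi)) /\
                 has_mean (fun t => cos (osc n E b x t + phi)) (P * cos phi)) /\
    ((forall j, (j < n)%nat -> Rabs (x j) <= 1) ->
       exp (- sumR n (fun j => x j ^ 2) / 4 - sumR n (fun j => x j ^ 4) / 8) <= P <=
       exp (- sumR n (fun j => x j ^ 2) / 4 - sumR n (fun j => x j ^ 4) / 128)).
Proof.
  induction n as [|n IH]; intros HE.
  { exists 1; split; [|intros _; unfold sumR; simpl].
    - intros phi.
      assert (Ec : forall t, cos (osc 0 E b x t + phi) = cos phi)
        by (intros t; unfold osc, sumR; simpl; now rewrite Rplus_0_l).
      split.
      + apply ap_trig; eapply trig_ext; [apply trig_const|exact Ec].
        apply phase_group_freqs, subgroup_lattice.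
      + rewrite Rmult_1_l; eapply has_mean_ext; [exact Ec|apply has_mean_const].
    - replace (- 0 / 4 - 0 / 8) with 0 by field.
      replace (- 0 / 4 - 0 / 128) with 0 by field; rewrite exp_0; lra. }
  destruct (IH (Q_lin_indep_S n E HE)) as (P & HP & BP).
  destruct (has_mean_cos_cos (E n) b (x n) (Q_lin_indep_neq_0 n E HE)) as (nu & Hnu & Bnu).
  exists (P * nu); split.
  - intros phi.
    (* cos (s + c) = cos s cos c - sin s sin c, with both sines rewritten as shifted cosines so that
       the induction hypothesis applies to each factor. The second product has mean zero since cos
       (PI / 2) = 0. *)
    assert (Ec : forall t, cos (osc (S n) E b x t + phi) =
      cos (osc n E b x t + 0) * cos (x n * cos (t * E n + b) + phi) +
      cos (osc n E b x t + PI / 2) * cos (x n * cos (t * E n + b) + (phi + - (PI / 2)))).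
    { intros t; unfold osc; rewrite sumR_S; fold (osc n E b x t).
      rewrite Rplus_assoc, <- Rplus_assoc.
      generalize (osc n E b x t) (x n * cos (t * E n + b)); intros s a.
      replace (a + (phi + - (PI / 2))) with ((a + phi) + - (PI / 2)) by ring.
      rewrite Rplus_0_r, Rplus_assoc; generalize (a + phi); intros c.
      rewrite (cos_plus s c), (cos_plus s (PI / 2)), (cos_plus c (- (PI / 2))).
      rewrite cos_neg, sin_neg, cos_PI2, sin_PI2; ring. }
    assert (HS : forall a, lattice n E a -> lattice (S n) E a) by apply lattice_S.
    assert (HL : forall a, multiples (E n) a -> lattice (S n) E a) by apply lattice_last.
    pose proof (subgroup_lattice (S n) E) as HG.
    split.
    + eapply ap_ext; [exact Ec|]; apply ap_plus; apply ap_mult; try easy.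
      * apply (ap_incl (lattice n E)); [easy|apply HP].
      * apply (ap_incl (multiples (E n))); [easy|apply ap_cos_cos].
      * apply (ap_incl (lattice n E)); [easy|apply HP].
      * apply (ap_incl (multiples (E n))); [easy|apply ap_cos_cos].
    + eapply has_mean_ext; [exact Ec|].
      replace (P * nu * cos phi) with ((P * cos 0) * (nu * cos phi)
        + (P * cos (PI / 2)) * (nu * cos (phi + - (PI / 2))))
        by (rewrite cos_0, cos_PI2; ring).
      assert (Hprod : forall psi chi, has_mean (fun t =>
          cos (osc n E b x t + psi) * cos (x n * cos (t * E n + b) + chi))
          (P * cos psi * (nu * cos chi))).
      { intros psi chi; destruct (HP psi) as [A1 A2].
        apply (ap_mean_mult (lattice n E) (multiples (E n)) (lattice (S n) E)
          _ _ _ _ (subgroup_multiples (E n)) HG); auto.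
        - intros a; now apply lattice_multiples.
        - apply ap_cos_cos. }
      apply has_mean_plus; apply Hprod.
  - intros Hx; rewrite !sumR_S.
    destruct (BP ltac:(intros; apply Hx; lia)) as [L1 U1].
    destruct (Bnu ltac:(apply Hx; lia)) as [L2 U2].
    set (A := sumR n (fun j => x j ^ 2)) in *; set (B := sumR n (fun j => x j ^ 4)) in *.
    replace (- (A + x n ^ 2) / 4 - (B + x n ^ 4) / 8) with
      ((- A / 4 - B / 8) + (- x n ^ 2 / 4 - x n ^ 4 / 8)) by field.
    replace (- (A + x n ^ 2) / 4 - (B + x n ^ 4) / 128) with
      ((- A / 4 - B / 128) + (- x n ^ 2 / 4 - x n ^ 4 / 128)) by field.
    rewrite !exp_plus.
    pose proof (exp_pos (- A / 4 - B / 8)); pose proof (exp_pos (- x n ^ 2 / 4 - x n ^ 4 / 8)).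
    split; apply Rmult_le_compat; lra.
Qed.

Lemma osc_trig n E b x : trig (freqs (lattice n E)) (osc n E b x).
Proof.
  induction n as [|n IH].
  - eapply trig_ext; [apply (trig_const _ (phase_group_freqs _ (subgroup_lattice 0 E)) 0)|easy].
  - apply (trig_plus _ (osc n E b x) (fun t => x n * cos (t * E n + b))).
    + apply (trig_incl (freqs (lattice n E))); [|exact IH].
      intros l (lam & Hlam & El); exists lam; split; [now apply lattice_S|easy].
    + apply (trig_scal _ (x n) (fun t => cos (t * E n + b))); [|easy].
      apply (trig_incl (freqs (multiples (E n)))); [|apply trig_cos_multiple].
      intros l (lam & Hlam & El); exists lam; split; [now apply lattice_last|easy].
    + intros t; unfold osc; now rewrite sumR_S.
Qed.

(** Cross terms vanish by independence, as a single cosine has mean 0; each squared cosine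
    contributes 1/2. *)
Lemma osc_mean_sq n E b x :
  Q_lin_indep n E ->
  has_mean (fun t => osc n E b x t ^ 2) (sumR n (fun j => x j ^ 2) / 2).
Proof.
  induction n as [|n IH]; intros HE.
  { apply (has_mean_ext (fun _ => 0)); [intros t; unfold osc, sumR; simpl; ring|].
    replace (sumR 0 (fun j => x j ^ 2) / 2) with 0 by (unfold sumR; simpl; field).
    apply has_mean_const. }
  specialize (IH (Q_lin_indep_S n E HE)).
  pose proof (Q_lin_indep_neq_0 n E HE) as HEn.
  destruct (ap_ex_mean (lattice n E) (osc n E b x)) as [m Hm]; [apply ap_trig, osc_trig|].
  assert (Hc : has_mean (fun t => cos (t * E n + b)) 0).
  { apply (has_mean_ext (fun t => cos (E n * t + b))); [|now apply has_mean_cos].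
    intros t; now rewrite (Rmult_comm t). }
  assert (Hx : has_mean (fun t => osc n E b x t * cos (t * E n + b)) (m * 0)).
  { apply (ap_mean_mult (lattice n E) (multiples (E n)) (lattice (S n) E)); try easy.
    - apply subgroup_multiples.
    - apply subgroup_lattice.
    - intros a H1 H2; now apply (lattice_multiples n E).
    - intros a; apply lattice_S.
    - intros a; apply lattice_last.
    - apply ap_trig, osc_trig.
    - apply ap_trig, trig_cos_multiple. }
  rewrite sumR_S.
  replace ((sumR n (fun j => x j ^ 2) + x n ^ 2) / 2) with
    (sumR n (fun j => x j ^ 2) / 2 + (2 * x n * (m * 0) + x n ^ 2 * / 2)) by field.
  apply (has_mean_ext (fun t => osc n E b x t ^ 2 +
    (2 * x n * (osc n E b x t * cos (t * E n + b)) + x n ^ 2 * cos (t * E n + b) ^ 2))).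
  - intros t; unfold osc; rewrite sumR_S; ring.
  - apply has_mean_plus; [easy|apply has_mean_plus]; apply has_mean_scal; [easy|].
    now apply has_mean_cos_sq.
Qed.

(** * Trigonometric approximation on the plane *)

Definition linear_form (l : C -> R) : Prop :=
  exists xi1 xi2, forall y, l y = xi1 * fst y + xi2 * snd y.

Lemma phase_group_linear_form : phase_group linear_form.
Proof.
  split; [|split].
  - exists 0, 0; intros; ring.
  - intros k l (a & b & Ek) (a' & b' & El); exists (a + a'), (b + b').
    intros y; rewrite Ek, El; ring.
  - intros k l (a & b & Ek) (a' & b' & El); exists (a - a'), (b - b').
    intros y; rewrite Ek, El; ring.
Qed.

(** Quantitative injectivity of the sine from sin a - sin b = 2 cos ((a + b) / 2) sin ((a - b) / 2).
    With [b] confined to the half-size interval, both half-angles stay within 3 PI / 8 of 0, away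
    from the zero of the cosine. *)
Lemma sin_separation del : 0 < del ->
  exists eta, 0 < eta /\
    forall a b, - (PI / 2) <= a <= PI / 2 -> - (PI / 4) <= b <= PI / 4 ->
      del <= Rabs (a - b) -> eta <= Rabs (sin a - sin b).
Proof.
  intros Hdel; pose proof PI_RGT_0 as HPI.
  set (w0 := Rmin (del / 2) (PI / 4)).
  assert (Hw0 : 0 < w0 <= PI / 4).
  { split; [apply Rmin_glb_lt; lra|apply Rmin_r]. }
  assert (Hs0 : 0 < sin w0) by (apply sin_gt_0; lra).
  assert (Hc0 : 0 < cos (3 * PI / 8)) by (apply cos_gt_0; lra).
  exists (2 * cos (3 * PI / 8) * sin w0); split.
  { apply Rmult_lt_0_compat; lra. }
  assert (Hc : forall v, Rabs v <= 3 * PI / 8 -> cos (3 * PI / 8) <= cos v).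
  { intros v Hv; replace (cos v) with (cos (Rabs v)).
    - apply cos_decr_1; try lra; apply Rabs_pos.
    - unfold Rabs; destruct Rcase_abs; [apply cos_neg|easy]. }
  assert (Hs : forall w, w0 <= Rabs w <= 3 * PI / 8 -> sin w0 <= Rabs (sin w)).
  { intros w Hw; replace (Rabs (sin w)) with (sin (Rabs w)).
    - apply sin_incr_1; lra.
    - assert (H : 0 <= sin (Rabs w)) by (apply sin_ge_0; lra).
      revert H; unfold Rabs at 1 2; destruct Rcase_abs; intros H.
      + rewrite sin_neg in *; rewrite Rabs_left1; lra.
      + rewrite Rabs_right; lra. }
  intros a b Ha Hb Hab; rewrite form4, !Rabs_mult, (Rabs_right 2) by lra.
  assert (H1 : cos (3 * PI / 8) <= cos ((a + b) / 2)).
  { apply Hc; apply Rabs_le; lra. }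
  apply Rmult_le_compat; [lra|lra| |].
  - rewrite (Rabs_right (cos _)); lra.
  - apply Hs; split.
    + apply Rle_trans with (del / 2); [apply Rmin_l|].
      unfold Rdiv; rewrite Rabs_mult, (Rabs_right (/ 2)) by lra; lra.
    + apply Rabs_le; lra.
Qed.

Lemma bounded_continuous_2d g : bounded_continuous g ->
  forall x y, continuity_2d_pt (fun u v => g (u, v)) x y.
Proof.
  intros [Cg _] x y; apply continuity_2d_pt_filterlim.
  apply (filterlim_ext g); [|exact (Cg (x, y))].
  intros [u v]; reflexivity.
Qed.

(* The approximant is a Bernstein polynomial of [g] in the variables
   [(1 + sin (c y_i)) / 2]: it is globally bounded by [sup |g|], so a
   quadratic weight controls the error outside a large square. *)
Lemma bounded_continuous_approx g eps : bounded_continuous g -> 0 < eps ->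
  exists Q, trig linear_form Q /\
    forall y, Rabs (g y - Q y) <= eps * (1 + (fst y ^ 2 + snd y ^ 2)).
Proof.
  intros Hg Heps; pose proof PI_RGT_0 as HPI.
  pose proof (bounded_continuous_2d g Hg) as Cg.
  destruct Hg as [_ [M0 HM0]].
  set (M := Rabs M0 + 1).
  assert (HM : forall y, Rabs (g y) <= M).
  { intros y; apply Rle_trans with (1 := HM0 y).
    pose proof (Rle_abs M0); unfold M; lra. }
  assert (HMpos : 0 < M) by (unfold M; pose proof (Rabs_pos M0); lra).
  (* Outside the square of half-side [L] the allowance [eps * L ^ 2] exceeds the trivial error
     [2 * M]. *)
  set (L := 1 + 2 * M / eps).
  assert (HL : 1 <= L).
  { unfold L; assert (0 < 2 * M / eps) by (apply Rdiv_lt_0_compat; lra); lra. }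
  assert (HL2 : 2 * M <= eps * L ^ 2).
  { assert (2 * M / eps <= L) by (unfold L; lra).
    apply Rle_div_l in H; [|easy]. nra. }
  (* On the square, [c * z] stays in the range where [sin_separation] admits [b]; the nodes [p j],
     being arcsines over [c], fill at most [-2 L, 2 L]. *)
  set (c := PI / (4 * L)).
  assert (Hc : 0 < c) by (apply Rdiv_lt_0_compat; lra).
  assert (HcL : c * L = PI / 4) by (unfold c; field; lra).
  destruct (uniform_continuity_2d (fun u v => g (u, v)) (-2 * L) (2 * L) (-2 * L) (2 * L)
    (fun x y _ _ => Cg x y) (mkposreal (eps / 2) ltac:(lra))) as [[del Hdel] Hunif];
    simpl in Hunif.
  destruct (sin_separation (c * del) ltac:(now apply Rmult_lt_0_compat))
    as (eta & Heta & Hsep).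
  (* [u] halves the sine, so sines at distance [eta] put the node values at distance [eta / 2],
     where the quadratic term pays for [2 * M]. *)
  set (K := 2 * M / (eta / 2) ^ 2).
  assert (HK : 0 < K) by (apply Rdiv_lt_0_compat; [lra|apply pow_lt; lra]).
  (* The two nested Bernstein operators cost [K / (4 * INR m)] each. *)
  destruct (archimed_div (K / 2) (eps / 2) ltac:(lra)) as (m & Hm & HmK).
  assert (HmR : 0 < INR m) by (apply lt_0_INR; lia).
  (* The point of the principal branch where [u] equals [j / m]. *)
  set (p := fun j => asin (2 * (INR j / INR m) - 1) / c).
  set (u := fun z => (1 + sin (c * z)) / 2).
  assert (Hu : forall z, 0 <= u z <= 1).
  { intros z; unfold u; pose proof (SIN_bound (c * z)); lra. }
  assert (Hcp : forall j, c * p j = asin (2 * (INR j / INR m) - 1)).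
  { intros j; unfold p; field; lra. }
  assert (Hp : forall j, -2 * L <= p j <= 2 * L).
  { intros j; pose proof (asin_bound (2 * (INR j / INR m) - 1)) as B.
    rewrite <- Hcp in B; split; nra. }
  assert (Hup : forall j, (j <= m)%nat -> 2 * (INR j / INR m) - 1 = sin (c * p j)).
  { intros j Hj; rewrite Hcp, sin_asin; [easy|].
    assert (0 <= INR j / INR m <= 1); [|lra].
    split; [apply Rdiv_le_0_compat; [apply pos_INR|easy]|].
    apply Rle_div_l; [easy|]; rewrite Rmult_1_l; now apply le_INR. }
  assert (Hfar : forall j z, (j <= m)%nat -> - L <= z <= L -> del <= Rabs (p j - z) ->
    2 * M <= K * (INR j / INR m - u z) ^ 2).
  { intros j z Hj Hz Hd.
    assert (S : eta <= Rabs (sin (c * p j) - sin (c * z))).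
    { apply Hsep.
      - rewrite Hcp; apply asin_bound.
      - split; nra.
      - rewrite <- Rmult_minus_distr_l, Rabs_mult, (Rabs_right c) by lra.
        apply Rmult_le_compat_l; lra. }
    rewrite <- (Hup j Hj) in S.
    replace (INR j / INR m - u z) with
      ((2 * (INR j / INR m) - 1 - sin (c * z)) / 2) by (unfold u; field; lra).
    set (D := 2 * (INR j / INR m) - 1 - sin (c * z)) in *.
    assert (HD : eta ^ 2 <= D ^ 2).
    { rewrite <- (pow2_abs D); apply pow_incr; lra. }
    assert (HKe : K * (eta / 2) ^ 2 = 2 * M) by (unfold K; field; lra).
    rewrite <- HKe; apply Rmult_le_compat_l; [lra|].
    unfold Rdiv; rewrite !Rpow_mult_distr; apply Rmult_le_compat_r; [|easy].
    apply pow2_ge_0. }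
  set (F := fun j k => g (p j, p k)).
  exists (fun y => bern m (u (fst y)) (fun j => bern m (u (snd y)) (F j) 0) 0).
  (* Positivity of the Bernstein operator: [bern_approx] with [K = 0] and centre 0, used twice. *)
  assert (Hglob : forall y,
    Rabs (bern m (u (fst y)) (fun j => bern m (u (snd y)) (F j) 0) 0) <= M).
  { intros y; rewrite <- (Rminus_0_r (bern _ _ _ _)).
    replace M with (M + 0 / (4 * INR m)) by (field; lra).
    apply bern_approx; try easy; intros j _.
    rewrite Rmult_0_l, Rplus_0_r; replace M with (M + 0 / (4 * INR m)) by (field; lra).
    apply bern_approx; try easy; intros k _.
    rewrite Rmult_0_l, Rplus_0_r, Rminus_0_r; apply HM. }
  split.
  - assert (Hw : forall l, linear_form l -> trig linear_form (fun y => u (l y))).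
    { intros l Hl.
      apply (trig_plus _ (fun _ => / 2) (fun y => / 2 * cos (c * l y + - (PI / 2)))).
      - apply trig_const, phase_group_linear_form.
      - apply (trig_scal _ (/ 2) (fun y => cos (c * l y + - (PI / 2)))); [|easy].
        apply (trig_cos _ (fun y => c * l y) (- (PI / 2))); [|easy].
        destruct Hl as (a & b & El); exists (c * a), (c * b); intros y; rewrite El; ring.
      - intros y; unfold u; rewrite cos_plus, cos_neg, sin_neg, cos_PI2, sin_PI2; field. }
    apply (trig_bern linear_form (fun y => u (fst y))
      (fun y j => bern m (u (snd y)) (F j) 0)); [apply phase_group_linear_form| |].
    + apply Hw; exists 1, 0; intros; ring.
    + intros j; apply (trig_bern linear_form (fun y => u (snd y)) (fun _ => F j));
        [apply phase_group_linear_form| |].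
      * apply Hw; exists 0, 1; intros; ring.
      * intros k; apply trig_const, phase_group_linear_form.
  - intros [y1 y2]; cbn [fst snd].
    pose proof (pow2_ge_0 y1) as P1; pose proof (pow2_ge_0 y2) as P2.
    destruct (Rle_dec (y1 ^ 2) (L ^ 2)) as [H1|H1]; [destruct (Rle_dec (y2 ^ 2) (L ^ 2)) as [H2|H2]|].
    2,3: specialize (Hglob (y1, y2)); cbn [fst snd] in Hglob;
      apply Rle_trans with (2 * M);
      [apply Rle_trans with (1 := Rabs_triang _ _); rewrite Rabs_Ropp;
       specialize (HM (y1, y2)); lra
      |apply Rle_trans with (1 := HL2); apply Rmult_le_compat_l; lra].
    assert (HB : forall z, z ^ 2 <= L ^ 2 -> - L <= z <= L).
    { intros z Hz; apply Rabs_le_between.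
      rewrite <- (Rabs_right L) by lra; apply Rsqr_le_abs_0; unfold Rsqr; lra. }
    apply HB in H1; apply HB in H2.
    rewrite Rabs_minus_sym.
    apply Rle_trans with ((eps / 2 + K / (4 * INR m)) + K / (4 * INR m)).
    2:{ replace (K / (4 * INR m)) with (K / 2 / INR m / 2) by (field; lra). nra. }
    apply bern_approx; [easy|apply Hu|lra|]; intros j Hj.
    (* The penalty in the first variable is constant for the inner operator and is passed to it as
       part of its [eps]. *)
    replace (eps / 2 + K / (4 * INR m) + K * (INR j / INR m - u y1) ^ 2) with
      (eps / 2 + K * (INR j / INR m - u y1) ^ 2 + K / (4 * INR m)) by ring.
    apply bern_approx; [easy|apply Hu|lra|]; intros k Hk.
    pose proof (pow2_ge_0 (INR j / INR m - u y1)) as Q1.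
    pose proof (pow2_ge_0 (INR k / INR m - u y2)) as Q2.
    assert (Q1' : 0 <= K * (INR j / INR m - u y1) ^ 2) by (apply Rmult_le_pos; lra).
    assert (Q2' : 0 <= K * (INR k / INR m - u y2) ^ 2) by (apply Rmult_le_pos; lra).
    destruct (Rlt_dec (Rabs (p j - y1)) del) as [D1|D1];
      [destruct (Rlt_dec (Rabs (p k - y2)) del) as [D2|D2]|].
    + enough (Rabs (F j k - g (y1, y2)) < eps / 2) by lra.
      apply Hunif; try easy; try apply Hp; lra.
    + pose proof (Hfar k y2 Hk H2 ltac:(lra)).
      apply Rle_trans with (2 * M); [|lra].
      apply Rle_trans with (1 := Rabs_triang _ _); rewrite Rabs_Ropp.
      pose proof (HM (p j, p k)); pose proof (HM (y1, y2)); unfold F; lra.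
    + pose proof (Hfar j y1 Hj H1 ltac:(lra)).
      apply Rle_trans with (2 * M); [|lra].
      apply Rle_trans with (1 := Rabs_triang _ _); rewrite Rabs_Ropp.
      pose proof (HM (p j, p k)); pose proof (HM (y1, y2)); unfold F; lra.
Qed.

(** * [Yn] as a pair of oscillating sums *)

Lemma polar_form xi1 xi2 :
  exists b, xi1 = sqrt (xi1 ^ 2 + xi2 ^ 2) * cos b /\ xi2 = sqrt (xi1 ^ 2 + xi2 ^ 2) * sin b.
Proof.
  set (r := sqrt (xi1 ^ 2 + xi2 ^ 2)).
  pose proof (pow2_ge_0 xi1); pose proof (pow2_ge_0 xi2).
  assert (Hr : 0 <= r) by apply sqrt_pos.
  assert (Hr2 : r ^ 2 = xi1 ^ 2 + xi2 ^ 2) by (apply pow2_sqrt; lra).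
  destruct (Req_dec r 0) as [E|E].
  { exists 0; rewrite E in *; split; nra. }
  assert (Hp : -1 <= xi1 / r <= 1).
  { split; [apply Rle_div_r|apply Rle_div_l]; nra. }
  assert (Hs : sqrt (1 - (xi1 / r)²) = Rabs xi2 / r).
  { replace (1 - (xi1 / r)²) with ((xi2 / r)²).
    - rewrite sqrt_Rsqr_abs; unfold Rdiv; rewrite Rabs_mult, Rabs_inv, (Rabs_right r) by lra; easy.
    - replace 1 with (r ^ 2 / r ^ 2) by (field; easy); rewrite Hr2 at 1.
      unfold Rsqr; field; easy. }
  destruct (Rle_dec 0 xi2) as [H2|H2].
  - exists (acos (xi1 / r)); rewrite cos_acos, sin_acos, Hs, Rabs_right by lra.
    split; field; easy.
  - exists (- acos (xi1 / r)); rewrite cos_neg, sin_neg, cos_acos, sin_acos, Hs, Rabs_left by lra.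
    split; field; easy.
Qed.

Lemma fst_sumC n f : fst (sumC n f) = sumR n (fun j => fst (f j)).
Proof.
  unfold sumC, sumR; generalize (seq 0 n); intros l.
  induction l as [|a l IH]; simpl; [easy|now rewrite IH].
Qed.

Lemma snd_sumC n f : snd (sumC n f) = sumR n (fun j => snd (f j)).
Proof.
  unfold sumC, sumR; generalize (seq 0 n); intros l.
  induction l as [|a l IH]; simpl; [easy|now rewrite IH].
Qed.

Definition weight (n : nat) (d : nat -> R) (j : nat) : R := d j / DeltaZ n d.

Lemma fst_Yn n E d t : fst (Yn n E d t) = osc n E 0 (weight n d) t.
Proof.
  unfold Yn, Zn, osc, weight; simpl; rewrite fst_sumC, Rmult_0_l, Rminus_0_r.
  rewrite <- sumR_scal; apply sumR_ext; intros j _; simpl.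
  rewrite Rplus_0_r; unfold Rdiv; ring.
Qed.

Lemma snd_Yn n E d t : snd (Yn n E d t) = osc n E (PI / 2) (weight n d) t.
Proof.
  unfold Yn, Zn, osc, weight; simpl; rewrite snd_sumC, Rmult_0_l, Rplus_0_r.
  rewrite <- sumR_scal; apply sumR_ext; intros j _; simpl.
  rewrite cos_plus, cos_PI2, sin_PI2; unfold Rdiv; ring.
Qed.

(** Projecting on a direction of the plane only shifts the common phase and scales the weights by
    the length of [xi]. *)
Lemma linear_form_Yn xi1 xi2 :
  exists b, forall n E d t,
    xi1 * fst (Yn n E d t) + xi2 * snd (Yn n E d t) =
    osc n E b (fun j => sqrt (xi1 ^ 2 + xi2 ^ 2) * weight n d j) t.
Proof.
  destruct (polar_form xi1 xi2) as (b & E1 & E2); exists b; intros n E d t.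
  rewrite fst_Yn, snd_Yn; unfold osc.
  rewrite <- !sumR_scal, <- sumR_plus; apply sumR_ext; intros j _.
  rewrite Rplus_0_r, (cos_plus _ (PI / 2)), cos_PI2, sin_PI2, cos_plus.
  rewrite E1 at 1; rewrite E2 at 2; ring.
Qed.

(** * Gaussian integrals *)

Definition is_int (f : R -> R) (l : R) : Prop :=
  is_RInt_gen f (Rbar_locally m_infty) (Rbar_locally p_infty) l.

Lemma is_int_ext f g l : (forall x, g x = f x) -> is_int f l -> is_int g l.
Proof.
  intros E; unfold is_int.
  apply (is_RInt_gen_ext (V := R_NormedModule) f g l).
  apply (Filter_prod _ _ _ (fun _ => True) (fun _ => True)); try (exists 0; easy).
  intros; now rewrite E.
Qed.

Lemma is_int_plus f g l m :
  is_int f l -> is_int g m -> is_int (fun x => f x + g x) (l + m).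
Proof. exact (is_RInt_gen_plus f g l m). Qed.

Lemma is_int_scal c f l : is_int f l -> is_int (fun x => c * f x) (c * l).
Proof. exact (is_RInt_gen_scal f c l). Qed.

Lemma is_int_le f g l m :
  is_int f l -> is_int g m -> (forall x, f x <= g x) -> l <= m.
Proof.
  intros Hf Hg Hfg.
  (* [RInt_gen_norm] bounds the norm of an integral. Applied to the zero function with majorant
     [g - f], it gives [m - l >= 0]. *)
  pose proof (is_int_scal 0 f l Hf) as H0.
  pose proof (is_int_plus _ _ _ _ Hg (is_int_scal (-1) f l Hf)) as H1.
  enough (Rabs (0 * l) <= m + (-1) * l) by (rewrite Rmult_0_l, Rabs_R0 in H; lra).
  refine (RInt_gen_norm (V := R_CompleteNormedModule) _ _ _ _ _ _ H0 H1).
  - apply (Filter_prod _ _ _ (fun a => a < 0) (fun b => 0 < b));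
      [exists 0; easy|exists 0; easy|intros a b; simpl; lra].
  - apply (Filter_prod _ _ _ (fun _ => True) (fun _ => True)); try (exists 0; easy).
    intros a b _ _ x _; change (Rabs (0 * f x) <= g x + -1 * f x).
    rewrite Rmult_0_l, Rabs_R0; specialize (Hfg x); lra.
Qed.

Lemma is_int_unique f l m : is_int f l -> is_int f m -> l = m.
Proof.
  intros H1 H2; apply Rle_antisym; eapply is_int_le; try eassumption;
    intros; apply Rle_refl.
Qed.

Lemma is_int_intro f l : cont f ->
  (forall eps, 0 < eps ->
     exists B, forall a b, a <= - B -> B <= b -> Rabs (RInt f a b - l) < eps) ->
  is_int f l.
Proof.
  intros Cf H P [eps HP].
  destruct (H eps (cond_pos eps)) as [B HB].
  apply (Filter_prod _ _ _ (fun a => a < - B) (fun b => B < b)); [now exists (- B)|now exists B|].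
  intros a b Ha Hb; exists (RInt f a b); split.
  - apply (RInt_correct f), cont_ex_RInt, Cf.
  - apply HP, HB; lra.
Qed.

Lemma dominated_nonneg f K : (forall x, Rabs (f x) <= K / (1 + x ^ 2)) -> 0 <= K.
Proof.
  intros Hf; apply Rle_trans with (1 := Rabs_pos (f 0)); apply Rle_trans with (1 := Hf 0).
  right; field.
Qed.

Lemma abs_RInt_le_atan f K a b :
  cont f -> (forall x, Rabs (f x) <= K / (1 + x ^ 2)) -> a <= b ->
  Rabs (RInt f a b) <= K * (atan b - atan a).
Proof.
  intros Cf Hf Hab.
  assert (Cg : cont (fun x => K / (1 + x ^ 2))).
  { intros x; apply (ex_derive_continuous (fun x => K / (1 + x ^ 2))).
    auto_derive; pose proof (pow2_ge_0 x); simpl in *; lra. }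
  assert (HI : is_RInt (fun x => K / (1 + x ^ 2)) a b (K * atan b - K * atan a)).
  { apply (is_RInt_derive (fun x => K * atan x)); [|intros; apply Cg].
    intros x _; evar_last.
    - apply (is_derive_scal atan x K (/ (1 + x²))), is_derive_atan.
    - unfold scal; simpl; unfold mult, Rsqr; simpl; unfold Rdiv; now rewrite Rmult_1_r. }
  replace (K * (atan b - atan a)) with (K * atan b - K * atan a) by ring.
  apply (norm_RInt_le f (fun x => K / (1 + x ^ 2)) a b); [easy| | |easy].
  - intros x _; apply Hf.
  - apply (RInt_correct f), cont_ex_RInt, Cf.
Qed.

Lemma atan_tail_small eps : 0 < eps -> exists B, 0 < B /\ PI / 2 - atan B < eps.
Proof.
  intros Heps; pose proof PI_RGT_0.
  set (e := Rmin (eps / 2) (PI / 4)).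
  assert (He : 0 < e) by (apply Rmin_glb_lt; lra).
  assert (He1 : e <= eps / 2) by apply Rmin_l.
  assert (He2 : e <= PI / 4) by apply Rmin_r.
  exists (tan (PI / 2 - e)); split; [apply tan_gt_0; lra|].
  rewrite atan_tan; lra.
Qed.

(** The majorant has the explicit primitive [K * atan], so the tail rate depends on [K] and [B]
    alone. This uniformity in [f] is what later gives continuity in a parameter. *)
Lemma dominated_is_int f K : cont f -> (forall x, Rabs (f x) <= K / (1 + x ^ 2)) ->
  exists l, is_int f l /\ Rabs l <= K * PI /\
    forall B a b, a <= - B -> B <= b ->
      Rabs (RInt f a b - l) <= 2 * K * (PI / 2 - atan B).
Proof.
  intros Cf Hf; pose proof PI_RGT_0.
  pose proof (dominated_nonneg f K Hf) as HK.
  (* Endpoints come in either order, because the Chasles relation produces signed integrals. *)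
  assert (Htail : forall B x y, B <= x -> B <= y ->
    Rabs (RInt f x y) <= K * (PI / 2 - atan B) /\
    Rabs (RInt f (- x) (- y)) <= K * (PI / 2 - atan B)).
  { intros B x y Hx Hy.
    assert (Hat : forall u v, u <= v -> atan u <= atan v).
    { intros u v [Huv| ->]; [left; now apply atan_increasing|lra]. }
    assert (Hmon : forall u v, B <= u -> u <= v ->
      Rabs (RInt f u v) <= K * (PI / 2 - atan B) /\
      Rabs (RInt f (- v) (- u)) <= K * (PI / 2 - atan B)).
    { intros u v Hu Huv; pose proof (atan_bound v); pose proof (Hat B u Hu); split.
      - apply Rle_trans with (1 := abs_RInt_le_atan f K u v Cf Hf Huv).
        apply Rmult_le_compat_l; lra.
      - apply Rle_trans with (1 := abs_RInt_le_atan f K (- v) (- u) Cf Hf ltac:(lra)).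
        rewrite !atan_opp; apply Rmult_le_compat_l; lra. }
    destruct (Rle_dec x y) as [Hxy|Hxy].
    - destruct (Hmon x y Hx Hxy) as [H1 H2]; split; [easy|].
      rewrite <- opp_RInt_swap by now apply cont_ex_RInt.
      change (Rabs (- RInt f (- y) (- x)) <= K * (PI / 2 - atan B)); now rewrite Rabs_Ropp.
    - destruct (Hmon y x Hy ltac:(lra)) as [H1 H2]; split; [|easy].
      rewrite <- opp_RInt_swap by now apply cont_ex_RInt.
      change (Rabs (- RInt f y x) <= K * (PI / 2 - atan B)); now rewrite Rabs_Ropp. }
  assert (Hcau : forall B a b a' b', a <= - B -> B <= b -> a' <= - B -> B <= b' ->
    Rabs (RInt f a b - RInt f a' b') <= 2 * K * (PI / 2 - atan B)).
  { intros B a b a' b' Ha Hb Ha' Hb'.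
    destruct (Htail B b' b Hb' Hb) as [H1 _].
    destruct (Htail B (- a) (- a') ltac:(lra) ltac:(lra)) as [_ H2].
    rewrite !Ropp_involutive in H2.
    pose proof (RInt_Chasles f a a' b (cont_ex_RInt f _ _ Cf) (cont_ex_RInt f _ _ Cf)) as C1.
    pose proof (RInt_Chasles f a' b' b (cont_ex_RInt f _ _ Cf) (cont_ex_RInt f _ _ Cf)) as C2.
    unfold plus in C1, C2; simpl in C1, C2.
    apply Rabs_le_between in H1; apply Rabs_le_between in H2; apply Rabs_le; lra. }
  assert (Hsmall : forall eps, 0 < eps ->
    exists B, 0 < B /\ 2 * K * (PI / 2 - atan B) < eps).
  { intros eps Heps.
    destruct (atan_tail_small (eps / (2 * K + 1))) as (B & HB & HB2);
      [apply Rdiv_lt_0_compat; lra|].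
    exists B; split; [easy|]; apply Rlt_div_r in HB2; [|lra].
    pose proof (atan_bound B); nra. }
  destruct (proj1 (filterlim_locally_cauchy
    (F := filter_prod (Rbar_locally m_infty) (Rbar_locally p_infty))
    (fun ab => RInt f (fst ab) (snd ab)))) as [l Hl].
  { intros eps; destruct (Hsmall eps (cond_pos eps)) as (B & _ & HB).
    exists (fun ab => fst ab < - B /\ B < snd ab); split.
    - apply (Filter_prod _ _ _ (fun a => a < - B) (fun b => B < b));
        [now exists (- B)|now exists B|easy].
    - intros [a b] [a' b'] [H1 H2] [H3 H4]; simpl in *.
      apply Rle_lt_trans with (2 := HB).
      change (Rabs (RInt f a' b' - RInt f a b) <= 2 * K * (PI / 2 - atan B)).
      apply Hcau; lra. }
  rewrite filterlim_locally in Hl.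
  assert (Hlim : forall B a b, a <= - B -> B <= b ->
      Rabs (RInt f a b - l) <= 2 * K * (PI / 2 - atan B)).
  { intros B a b Ha Hb; apply le_epsilon; intros eps Heps.
    destruct (Hl (mkposreal eps Heps)) as [Q S [M1 HQ] [M2 HS] HQS].
    (* Beyond [B] and both filter thresholds at once. *)
    set (N := Rabs B + Rabs M1 + Rabs M2 + 1).
    assert (HN : B <= N /\ - N < M1 /\ M2 < N).
    { pose proof (Rle_abs B); pose proof (Rle_abs M2); pose proof (Rle_abs (- M1)) as HM.
      rewrite Rabs_Ropp in HM; pose proof (Rabs_pos B); pose proof (Rabs_pos M1).
      pose proof (Rabs_pos M2); unfold N; lra. }
    assert (D : Rabs (RInt f (- N) N - l) < eps)
      by (apply (HQS (- N) N); [apply HQ|apply HS]; easy).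
    pose proof (Hcau B a b (- N) N Ha Hb ltac:(lra) ltac:(lra)) as D2.
    apply Rabs_def2 in D; apply Rabs_le_between in D2; apply Rabs_le; lra. }
  exists l; split; [|split; [|easy]].
  - apply is_int_intro; [easy|]; intros eps Heps.
    destruct (Hsmall eps Heps) as (B & _ & HB); exists B; intros a b Ha Hb.
    apply Rle_lt_trans with (2 := HB); now apply Hlim.
  - apply le_epsilon; intros eps Heps.
    destruct (Hsmall eps Heps) as (B & HB0 & HB).
    pose proof (Hlim B (- B) B ltac:(lra) ltac:(lra)) as H1.
    pose proof (abs_RInt_le_atan f K (- B) B Cf Hf ltac:(lra)) as H2.
    pose proof (atan_bound B); pose proof (atan_bound (- B)).
    assert (K * (atan B - atan (- B)) <= K * PI) by (apply Rmult_le_compat_l; lra).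
    apply Rabs_le_between in H1; apply Rabs_le_between in H2; apply Rabs_le; lra.
Qed.

(** Domination already gives existence, so the value may be read off along symmetric windows. *)
Lemma is_int_symmetric_limit f K l : cont f ->
  (forall x, Rabs (f x) <= K / (1 + x ^ 2)) ->
  (forall eps, 0 < eps -> exists B, forall N, B <= N -> Rabs (RInt f (- N) N - l) <= eps) ->
  is_int f l.
Proof.
  intros Cf Hf H; pose proof PI_RGT_0.
  destruct (dominated_is_int f K Cf Hf) as (l' & Hl' & _ & Htail).
  enough (l' = l) by now subst l'.
  pose proof (dominated_nonneg f K Hf) as HK.
  apply Rminus_diag_uniq, Rabs_eq_0, Rle_antisym; [|apply Rabs_pos].
  apply le_epsilon; intros eps Heps; rewrite Rplus_0_l.
  destruct (H (eps / 2) ltac:(lra)) as [B HB].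
  destruct (atan_tail_small (eps / 2 / (2 * K + 1))) as (B' & HB' & HB2);
    [apply Rdiv_lt_0_compat; lra|].
  set (N := Rmax B B').
  specialize (HB N (Rmax_l _ _)).
  pose proof (Rmax_r B B') as HN; fold N in HN.
  specialize (Htail B' (- N) N ltac:(lra) HN).
  apply Rlt_div_r in HB2; [|lra].
  pose proof (atan_bound B').
  apply Rabs_le_between in HB; apply Rabs_le_between in Htail; apply Rabs_le; nra.
Qed.

(** * The Gaussian weight and its Fourier transform *)

Lemma exp_monotone x y : x <= y -> exp x <= exp y.
Proof. intros [H| ->]; [left; now apply exp_increasing|apply Rle_refl]. Qed.

Definition gamma (x : R) : R := exp (- x ^ 2).

Lemma gamma_pos x : 0 < gamma x.
Proof. apply exp_pos. Qed.

Lemma gamma_le x : gamma x <= 1 / (1 + x ^ 2).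
Proof.
  unfold gamma; rewrite exp_Ropp; pose proof (exp_ineq1_le (x ^ 2)); pose proof (pow2_ge_0 x).
  rewrite Rdiv_1_l; apply Rinv_le_contravar; lra.
Qed.

Lemma is_derive_gamma x : is_derive gamma x (- (2 * x) * gamma x).
Proof. unfold gamma; auto_derive; [easy|]; simpl; ring. Qed.

Lemma cont_gamma : cont gamma.
Proof. exact (cont_of_derive _ _ is_derive_gamma). Qed.

Lemma continuity_pt_gamma x : continuity_pt gamma x.
Proof. apply continuity_pt_filterlim, cont_gamma. Qed.

Lemma cont_cos_gamma xi phi : cont (fun x => cos (xi * x + phi) * gamma x).
Proof. apply cont_mult; [apply cont_cos_affine|apply cont_gamma]. Qed.

Lemma cos_gamma_le xi phi x :
  Rabs (cos (xi * x + phi) * gamma x) <= 1 / (1 + x ^ 2).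
Proof.
  rewrite Rabs_mult, (Rabs_right (gamma x)) by apply Rle_ge, Rlt_le, gamma_pos.
  apply Rle_trans with (2 := gamma_le x).
  rewrite <- (Rmult_1_l (gamma x)) at 2; apply Rmult_le_compat_r; [apply Rlt_le, gamma_pos|].
  apply Rabs_le, COS_bound.
Qed.

Lemma gamma_small eps : 0 < eps -> exists B, forall N, B <= N -> gamma N <= eps.
Proof.
  intros Heps; exists (1 + / eps); intros N HN.
  apply Rinv_0_lt_compat in Heps as Hi.
  apply Rle_trans with (1 := gamma_le N).
  rewrite Rdiv_1_l, <- (Rinv_inv eps); apply Rinv_le_contravar; [easy|]; nra.
Qed.

Lemma is_derive_RInt_param_R (f df : R -> R -> R) a b x :
  (forall u t, is_derive (fun z => f z t) u (df u t)) ->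
  (forall t, continuity_2d_pt df x t) -> (forall u, cont (f u)) ->
  is_derive (fun u => RInt (f u) a b) x (RInt (df x) a b).
Proof.
  intros Hd Hc Cf.
  assert (E : forall u t, Derive (fun z => f z t) u = df u t)
    by (intros; apply is_derive_unique, Hd).
  rewrite (RInt_ext (df x) (fun t => Derive (fun u => f u t) x)) by (intros; now rewrite E).
  apply (is_derive_RInt_param (fun u t => f u t)).
  - apply filter_forall; intros u t _; exists (df u t); apply Hd.
  - intros t _; apply continuity_2d_pt_ext with df; [intros; now rewrite E|apply Hc].
  - apply filter_forall; intros u; apply cont_ex_RInt, Cf.
Qed.

Lemma zero_derive_const f : (forall x, is_derive f x 0) -> forall x, f x = f 0.
Proof.
  intros Hf x; destruct (MVT_gen f 0 x (fun _ => 0)) as (c & _ & E).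
  - intros; apply Hf.
  - intros y _; apply continuity_pt_filterlim, (cont_of_derive f (fun _ => 0) Hf).
  - lra.
Qed.

(** Companion integrand in the classical evaluation of the Gaussian integral: the denominator
    cancels under differentiation in [x]. *)
Definition gamma_aux (x t : R) : R := exp (- (x ^ 2 * (1 + t ^ 2))) / (1 + t ^ 2).

(* The derivative in [x] of the left-hand side vanishes. *)
Lemma gamma_square_identity x :
  RInt gamma 0 x ^ 2 + RInt (gamma_aux x) 0 1 = PI / 4.
Proof.
  assert (Hpos : forall t, 0 < 1 + t ^ 2) by (intros t; pose proof (pow2_ge_0 t); lra).
  assert (Ca : forall u, cont (gamma_aux u)).
  { intros u t; apply (ex_derive_continuous (gamma_aux u)); unfold gamma_aux.
    auto_derive; pose proof (Hpos t); simpl in *; lra. }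
  assert (HA : forall u, is_derive (fun z => RInt gamma 0 z) u (gamma u)).
  { intros u; apply (is_derive_RInt gamma _ 0); [|apply cont_gamma].
    apply filter_forall; intros z; apply (RInt_correct gamma), cont_ex_RInt, cont_gamma. }
  set (df := fun u t => - (2 * u) * (gamma u * gamma (u * t))).
  assert (HB : forall u, is_derive (fun z => RInt (gamma_aux z) 0 1) u (RInt (df u) 0 1)).
  { intros u; apply is_derive_RInt_param_R; [| |apply Ca].
    - intros z t; unfold gamma_aux, df, gamma; auto_derive.
      + pose proof (Hpos t); simpl in *; lra.
      + rewrite <- exp_plus.
        replace (- (z * (z * 1) * (1 + t * (t * 1)))) with (- z ^ 2 + - (z * t) ^ 2) by ring.
        field; pose proof (Hpos t); simpl in *; lra.
    - intros t; unfold df.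
      apply (continuity_2d_pt_mult (fun z _ => - (2 * z))).
      + apply continuity_2d_pt_opp, continuity_2d_pt_mult;
          [apply continuity_2d_pt_const|apply continuity_2d_pt_id1].
      + apply (continuity_2d_pt_mult (fun z _ => gamma z)).
        * apply (continuity_1d_2d_pt_comp gamma (fun z _ => z));
            [apply continuity_pt_gamma|apply continuity_2d_pt_id1].
        * apply (continuity_1d_2d_pt_comp gamma (fun z v => z * v)); [apply continuity_pt_gamma|].
          apply continuity_2d_pt_mult; [apply continuity_2d_pt_id1|apply continuity_2d_pt_id2]. }
  assert (HBA : forall u, RInt (df u) 0 1 = - 2 * gamma u * RInt gamma 0 u).
  { intros u.
    assert (Cg : cont (fun t => u * gamma (u * t + 0))).
    { apply cont_mult; [apply cont_const|].
      apply (cont_comp (fun t => u * t + 0) gamma); [|apply cont_gamma].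
      apply cont_plus; [apply cont_mult; [apply cont_const|apply cont_id]|apply cont_const]. }
    (* Substitution of [u * t]; it also covers [u = 0], where both sides vanish. *)
    pose proof (RInt_comp_lin (V := R_CompleteNormedModule) gamma u 0 0 1
      (cont_ex_RInt _ _ _ cont_gamma)) as H.
    rewrite Rmult_0_r, Rmult_1_r, !Rplus_0_r in H; rewrite <- H.
    rewrite (RInt_ext (df u) (fun t => scal (- 2 * gamma u) (u * gamma (u * t + 0)))).
    - rewrite (RInt_scal (V := R_CompleteNormedModule)); [reflexivity|].
      now apply cont_ex_RInt.
    - intros t _; unfold df, scal; simpl; unfold mult; simpl; rewrite Rplus_0_r; ring. }
  rewrite (zero_derive_const (fun u => RInt gamma 0 u ^ 2 + RInt (gamma_aux u) 0 1)).
  - rewrite RInt_point.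
    rewrite (RInt_ext (gamma_aux 0) (fun t => / (1 + t²))).
    + assert (E : RInt (fun t => / (1 + t²)) 0 1 = atan 1 - atan 0).
      { apply is_RInt_unique, (is_RInt_derive atan); intros t _; [apply is_derive_atan|].
        apply (ex_derive_continuous (fun t => / (1 + t²))).
        unfold Rsqr; auto_derive; pose proof (Hpos t); simpl in *; lra. }
      rewrite E, atan_1, atan_0; unfold zero; simpl; ring.
    + intros t _; unfold gamma_aux, Rsqr.
      replace (- (0 ^ 2 * (1 + t ^ 2))) with 0 by ring; rewrite exp_0, Rdiv_1_l.
      f_equal; ring.
  - intros u; evar_last.
    + apply (is_derive_plus (fun u => RInt gamma 0 u ^ 2) (fun u => RInt (gamma_aux u) 0 1)).
      * apply (is_derive_pow (fun u => RInt gamma 0 u) 2); apply HA.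
      * apply HB.
    + rewrite HBA; unfold plus; simpl; ring.
Qed.

Lemma RInt_gamma_aux_bounds x : 0 <= RInt (gamma_aux x) 0 1 <= gamma x.
Proof.
  assert (Hpos : forall t, 0 < 1 + t ^ 2) by (intros t; pose proof (pow2_ge_0 t); lra).
  assert (Ca : cont (gamma_aux x)).
  { intros t; apply (ex_derive_continuous (gamma_aux x)); unfold gamma_aux.
    auto_derive; pose proof (Hpos t); simpl in *; lra. }
  assert (Hb : forall t, 0 <= gamma_aux x t <= gamma x).
  { intros t; specialize (Hpos t); unfold gamma_aux, gamma; split.
    - apply Rdiv_le_0_compat; [apply Rlt_le, exp_pos|easy].
    - apply Rle_div_l; [easy|].
      replace (- (x ^ 2 * (1 + t ^ 2))) with (- x ^ 2 + - (x * t) ^ 2) by ring.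
      rewrite exp_plus; apply Rmult_le_compat_l; [apply Rlt_le, exp_pos|].
      apply Rle_trans with 1; [|pose proof (pow2_ge_0 t); lra].
      rewrite <- exp_0; apply exp_monotone; pose proof (pow2_ge_0 (x * t)); lra. }
  split.
  - apply RInt_ge_0; [lra|now apply cont_ex_RInt|intros; apply Hb].
  - assert (H : Rabs (RInt (gamma_aux x) 0 1) <= (1 - 0) * gamma x).
    { apply abs_RInt_le_const; [lra|now apply cont_ex_RInt|]; intros t _.
      rewrite Rabs_right; [apply Hb|apply Rle_ge, Hb]. }
    apply Rabs_le_between in H; lra.
Qed.

Lemma RInt_gamma_symmetric x : RInt gamma (- x) x = 2 * RInt gamma 0 x.
Proof.
  set (F := fun z => RInt gamma 0 z).
  assert (HA : forall u, is_derive F u (gamma u)).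
  { intros u; apply (is_derive_RInt gamma _ 0); [|apply cont_gamma].
    apply filter_forall; intros z; apply (RInt_correct gamma), cont_ex_RInt, cont_gamma. }
  (* [gamma] is even, so [F z + F (- z)] has derivative zero. *)
  assert (Hodd : F x + F (- x) = F 0 + F (- 0)).
  { apply (zero_derive_const (fun z => F z + F (- z))); intros z.
    assert (Ho : is_derive (fun z => - z) z (-1)) by (auto_derive; [easy|ring]).
    pose proof (is_derive_plus _ _ _ _ _ (HA z)
      (is_derive_comp F (fun z => - z) z _ _ (HA (- z)) Ho)) as H.
    replace 0 with (gamma z + -1 * gamma (- z)); [exact H|].
    replace (gamma (- z)) with (gamma z) by (unfold gamma; f_equal; ring); ring. }
  assert (H0 : F 0 = 0) by exact (RInt_point (V := R_CompleteNormedModule) 0 gamma).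
  assert (H1 : RInt gamma (- x) 0 + F x = RInt gamma (- x) x)
    by (apply (RInt_Chasles gamma); apply cont_ex_RInt, cont_gamma).
  assert (H2 : - F (- x) = RInt gamma (- x) 0)
    by (apply (opp_RInt_swap gamma), cont_ex_RInt, cont_gamma).
  rewrite Ropp_0, H0 in Hodd; rewrite <- H1, <- H2; fold (F x); lra.
Qed.

(** The identity factors as (sqrt PI - 2 A) (sqrt PI + 2 A) = 4 b, with [b] at most [gamma x]. *)
Lemma RInt_gamma_close x : 0 <= x ->
  Rabs (RInt gamma (- x) x - sqrt PI) <= 4 * gamma x / sqrt PI.
Proof.
  intros Hx; rewrite RInt_gamma_symmetric; set (A := RInt gamma 0 x).
  pose proof (gamma_square_identity x) as E; fold A in E.
  pose proof (RInt_gamma_aux_bounds x) as B; set (b := RInt (gamma_aux x) 0 1) in *.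
  pose proof PI_RGT_0 as HPI.
  assert (Hs : 0 < sqrt PI) by now apply sqrt_lt_R0.
  assert (Hs2 : sqrt PI * sqrt PI = PI) by (apply sqrt_sqrt; lra).
  assert (HA : 0 <= A).
  { apply RInt_ge_0; [easy|apply cont_ex_RInt, cont_gamma|intros; apply Rlt_le, gamma_pos]. }
  assert (HF : (sqrt PI - 2 * A) * (sqrt PI + 2 * A) = 4 * b) by nra.
  rewrite Rabs_minus_sym; apply Rle_div_r; [easy|].
  rewrite Rabs_right by nra. nra.
Qed.

(** By parts, the truncated transform I satisfies I' = - (u / 2) I plus a boundary term; the
    integrating factor exp (u^2/4) leaves the boundary term alone. *)
Lemma RInt_cos_gamma_ode xi phi N :
  is_derive (fun u => exp (u ^ 2 / 4) * RInt (fun x => cos (u * x + phi) * gamma x) (- N) N) xi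
    (exp (xi ^ 2 / 4) * ((sin (xi * N + phi) - sin (xi * - N + phi)) * gamma N / 2)).
Proof.
  set (f := fun u x => cos (u * x + phi) * gamma x).
  set (df := fun u x => - x * sin (u * x + phi) * gamma x).
  assert (Cdf : forall u, cont (df u)).
  { intros u x; apply (ex_derive_continuous (df u)); unfold df, gamma; auto_derive; easy. }
  assert (H1 : is_derive (fun u => RInt (f u) (- N) N) xi (RInt (df xi) (- N) N)).
  { apply is_derive_RInt_param_R; [| |intros u; apply cont_cos_gamma].
    - intros u t; unfold f, df; auto_derive; [easy|ring].
    - intros t; unfold df.
      apply continuity_2d_pt_mult; [apply continuity_2d_pt_mult|].
      + apply continuity_2d_pt_opp, continuity_2d_pt_id2.
      + apply (continuity_1d_2d_pt_comp sin (fun u x => u * x + phi)).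
        * apply continuity_sin.
        * apply continuity_2d_pt_plus; [|apply continuity_2d_pt_const].
          apply continuity_2d_pt_mult; [apply continuity_2d_pt_id1|apply continuity_2d_pt_id2].
      + apply (continuity_1d_2d_pt_comp gamma (fun _ x => x));
          [apply continuity_pt_gamma|apply continuity_2d_pt_id2]. }
  assert (H2 : RInt (df xi) (- N) N =
    (sin (xi * N + phi) - sin (xi * - N + phi)) * gamma N / 2 - xi / 2 * RInt (f xi) (- N) N).
  { assert (E : is_RInt (fun x => df xi x + xi / 2 * f xi x) (- N) N
      (sin (xi * N + phi) * gamma N / 2 - sin (xi * - N + phi) * gamma (- N) / 2)).
    { apply (is_RInt_derive (fun x => sin (xi * x + phi) * gamma x / 2)).
      - intros x _; unfold df, f, gamma; auto_derive; [easy|]; simpl; field.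
      - intros x _; apply cont_plus; [apply Cdf|].
        apply cont_mult; [apply cont_const|apply cont_cos_gamma]. }
    apply (is_RInt_unique (V := R_CompleteNormedModule)) in E.
    assert (E2 : RInt (fun x => df xi x + xi / 2 * f xi x) (- N) N =
      RInt (df xi) (- N) N + xi / 2 * RInt (f xi) (- N) N).
    { etransitivity; [apply (RInt_plus (df xi) (fun x => xi / 2 * f xi x))|].
      - now apply cont_ex_RInt.
      - apply cont_ex_RInt, cont_mult; [apply cont_const|apply cont_cos_gamma].
      - apply (f_equal (Rplus (RInt (df xi) (- N) N))).
        apply (RInt_scal (V := R_CompleteNormedModule) (f xi)).
        apply cont_ex_RInt, cont_cos_gamma. }
    replace (gamma (- N)) with (gamma N) in E by (unfold gamma; f_equal; ring).
    lra. }
  evar_last.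
  - apply (is_derive_mult (fun u => exp (u ^ 2 / 4)) (fun u => RInt (f u) (- N) N)).
    + instantiate (1 := xi / 2 * exp (xi ^ 2 / 4)); auto_derive; [easy|].
      replace (xi ^ 2 / 4) with (xi * (xi * 1) * / 4) by field; field.
    + apply H1.
    + intros; apply Rmult_comm.
  - rewrite H2; unfold plus, mult; simpl; field.
Qed.

(** Mean value theorem between 0 and [xi]: as |c| <= |xi|, the exponentials multiply to at most 1,
    and half a difference of sines leaves [gamma N]. *)
Lemma RInt_cos_gamma_close xi phi N :
  Rabs (RInt (fun x => cos (xi * x + phi) * gamma x) (- N) N
        - exp (- (xi ^ 2 / 4)) * (cos phi * RInt gamma (- N) N)) <= Rabs xi * gamma N.
Proof.
  set (G := fun u => exp (u ^ 2 / 4) * RInt (fun x => cos (u * x + phi) * gamma x) (- N) N).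
  assert (HG0 : G 0 = cos phi * RInt gamma (- N) N).
  { unfold G; replace (0 ^ 2 / 4) with 0 by field; rewrite exp_0, Rmult_1_l.
    rewrite (RInt_ext _ (fun x => scal (cos phi) (gamma x))).
    - apply (RInt_scal (V := R_CompleteNormedModule) gamma), cont_ex_RInt, cont_gamma.
    - intros x _; rewrite Rmult_0_l, Rplus_0_l; reflexivity. }
  destruct (MVT_gen G 0 xi (fun u => exp (u ^ 2 / 4) *
    ((sin (u * N + phi) - sin (u * - N + phi)) * gamma N / 2))) as (c & Hc & E).
  { intros u _; apply RInt_cos_gamma_ode. }
  { intros u _; apply continuity_pt_filterlim, (cont_of_derive G _
      (fun u => RInt_cos_gamma_ode u phi N)). }
  assert (Hc2 : c ^ 2 <= xi ^ 2).
  { unfold Rmin, Rmax in Hc; destruct (Rle_dec 0 xi); nra. }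
  rewrite HG0, Rminus_0_r in E.
  replace (RInt (fun x => cos (xi * x + phi) * gamma x) (- N) N) with
    (exp (- (xi ^ 2 / 4)) * G xi).
  2:{ unfold G; rewrite <- Rmult_assoc, <- exp_plus, Rplus_opp_l, exp_0; apply Rmult_1_l. }
  rewrite <- Rmult_minus_distr_l, E.
  pose proof (SIN_bound (c * N + phi)); pose proof (SIN_bound (c * - N + phi)).
  pose proof (gamma_pos N).
  rewrite !Rabs_mult, (Rabs_right (exp _)) by (apply Rle_ge, Rlt_le, exp_pos).
  rewrite (Rabs_right (exp _)) by (apply Rle_ge, Rlt_le, exp_pos).
  unfold Rdiv at 3; rewrite !Rabs_mult, (Rabs_right (gamma N)), (Rabs_right (/ 2)) by lra.
  rewrite <- !Rmult_assoc, <- exp_plus, (Rmult_comm (Rabs xi)).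
  apply Rmult_le_compat_r; [apply Rabs_pos|].
  assert (He1 : exp (- (xi ^ 2 / 4) + c ^ 2 / 4) <= 1)
    by (rewrite <- exp_0; apply exp_monotone; lra).
  assert (Hs2 : Rabs (sin (c * N + phi) - sin (c * - N + phi)) <= 2) by (apply Rabs_le; lra).
  pose proof (exp_pos (- (xi ^ 2 / 4) + c ^ 2 / 4)).
  pose proof (Rabs_pos (sin (c * N + phi) - sin (c * - N + phi))).
  assert (exp (- (xi ^ 2 / 4) + c ^ 2 / 4)
    * Rabs (sin (c * N + phi) - sin (c * - N + phi)) <= 1 * 2)
    by (apply Rmult_le_compat; lra).
  nra.
Qed.

Lemma is_int_cos_gamma xi phi :
  is_int (fun x => cos (xi * x + phi) * gamma x) (sqrt PI * exp (- (xi ^ 2 / 4)) * cos phi).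
Proof.
  apply (is_int_symmetric_limit _ 1); [apply cont_cos_gamma|apply cos_gamma_le|].
  intros eps Heps.
  assert (Hs : 0 < sqrt PI) by apply sqrt_lt_R0, PI_RGT_0.
  set (k := Rabs xi + 4 / sqrt PI + 1).
  assert (Hk1 : 0 < 4 / sqrt PI) by (apply Rdiv_lt_0_compat; lra).
  assert (Hk : 0 < k) by (unfold k; pose proof (Rabs_pos xi); lra).
  destruct (gamma_small (eps / k) ltac:(now apply Rdiv_lt_0_compat)) as [B HB].
  exists (Rmax 0 B); intros N HN.
  specialize (HB N (Rle_trans _ _ _ (Rmax_r _ _) HN)); apply Rle_div_r in HB; [|easy].
  pose proof (RInt_gamma_close N (Rle_trans _ _ _ (Rmax_l _ _) HN)) as H1.
  pose proof (RInt_cos_gamma_close xi phi N) as H2.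
  set (I := RInt gamma (- N) N) in *.
  set (J := RInt (fun x => cos (xi * x + phi) * gamma x) (- N) N) in *.
  set (e := exp (- (xi ^ 2 / 4))) in *.
  assert (He : 0 < e <= 1).
  { split; [apply exp_pos|]; rewrite <- exp_0; apply exp_monotone; pose proof (pow2_ge_0 xi); lra. }
  replace (J - sqrt PI * e * cos phi) with
    ((J - e * (cos phi * I)) + e * cos phi * (I - sqrt PI)) by ring.
  apply Rle_trans with (1 := Rabs_triang _ _).
  rewrite !(Rabs_mult _ (I - sqrt PI)).
  assert (H3 : Rabs (e * cos phi) <= 1).
  { rewrite Rabs_mult, (Rabs_right e) by lra.
    assert (Rabs (cos phi) <= 1) by apply Rabs_le, COS_bound.
    pose proof (Rabs_pos (cos phi)); nra. }
  assert (H4 : Rabs (e * cos phi) * Rabs (I - sqrt PI) <= 1 * (4 * gamma N / sqrt PI))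
    by (apply Rmult_le_compat; try apply Rabs_pos; easy).
  replace (4 * gamma N / sqrt PI) with (4 / sqrt PI * gamma N) in H4 by (field; lra).
  unfold k in HB; pose proof (gamma_pos N); lra.
Qed.

Lemma is_int_gamma : is_int gamma (sqrt PI).
Proof.
  replace (sqrt PI) with (sqrt PI * exp (- (0 ^ 2 / 4)) * cos 0).
  - apply (is_int_ext (fun x => cos (0 * x + 0) * gamma x)); [|apply is_int_cos_gamma].
    intros x; rewrite Rmult_0_l, Rplus_0_l, cos_0; ring.
  - replace (- (0 ^ 2 / 4)) with 0 by field; rewrite exp_0, cos_0; ring.
Qed.

(** Integration by parts reduces the second moment to half the total mass, up to [N * gamma N]. *)
Lemma is_int_sq_gamma : is_int (fun x => x ^ 2 * gamma x) (sqrt PI / 2).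
Proof.
  assert (Cf : cont (fun x => x ^ 2 * gamma x)) by (apply cont_mult; [apply cont_pow|apply cont_gamma]).
  apply (is_int_symmetric_limit _ 4); [easy| |].
  - intros x; pose proof (gamma_pos x); pose proof (pow2_ge_0 x).
    rewrite Rabs_right by (apply Rle_ge, Rmult_le_pos; lra).
    unfold gamma; rewrite exp_Ropp; pose proof (exp_pos (x ^ 2)).
    set (z := x ^ 2) in *; set (w := exp z) in *.
    (* exp z >= (1 + z/2)^2, whence z (1 + z) <= 4 exp z and the constant 4. *)
    assert (Hw : 1 + z + z ^ 2 / 4 <= w).
    { unfold w; pose proof (exp_ineq1_le (z / 2)).
      replace z with (z / 2 + z / 2) at 3 by field; rewrite exp_plus; nra. }
    change (z / w <= 4 / (1 + z)); apply (Rle_div_r (z / w)); [lra|].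
    replace (z / w * (1 + z)) with (z * (1 + z) / w) by (field; lra).
    apply (Rle_div_l (z * (1 + z))); nra.
  - intros eps Heps.
    assert (Hs : 0 < sqrt PI) by apply sqrt_lt_R0, PI_RGT_0.
    set (k := 4 / sqrt PI).
    assert (Hk : 0 < k) by (apply Rdiv_lt_0_compat; lra).
    destruct (gamma_small (eps / k) ltac:(now apply Rdiv_lt_0_compat)) as [B HB].
    (* 2 / eps makes the boundary term, below 1 / N, at most eps / 2. *)
    exists (Rmax (2 / eps) B); intros N HN.
    specialize (HB N (Rle_trans _ _ _ (Rmax_r _ _) HN)); apply Rle_div_r in HB; [|easy].
    pose proof (Rle_trans _ _ _ (Rmax_l _ _) HN) as HN2.
    assert (HN0 : 0 < N) by (apply Rlt_le_trans with (2 := HN2); apply Rdiv_lt_0_compat; lra).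
    pose proof (RInt_gamma_close N ltac:(lra)) as H1.
    replace (4 * gamma N / sqrt PI) with (k * gamma N) in H1 by (unfold k; field; lra).
    assert (E : RInt (fun x => x ^ 2 * gamma x) (- N) N =
      / 2 * RInt gamma (- N) N - N * gamma N).
    { assert (E : is_RInt (fun x => / 2 * gamma x - x ^ 2 * gamma x) (- N) N
        (N * gamma N / 2 - - N * gamma (- N) / 2)).
      { apply (is_RInt_derive (fun x => x * gamma x / 2)).
        - intros x _; unfold gamma; auto_derive; [easy|]; simpl; field.
        - intros x _; apply (ex_derive_continuous (fun x => / 2 * gamma x - x ^ 2 * gamma x)).
          unfold gamma; auto_derive; easy. }
      apply (is_RInt_unique (V := R_CompleteNormedModule)) in E.
      assert (E2 : RInt (fun x => / 2 * gamma x - x ^ 2 * gamma x) (- N) N =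
        / 2 * RInt gamma (- N) N - RInt (fun x => x ^ 2 * gamma x) (- N) N).
      { etransitivity; [apply (RInt_minus (fun x => / 2 * gamma x) (fun x => x ^ 2 * gamma x))|].
        - apply cont_ex_RInt, cont_mult; [apply cont_const|apply cont_gamma].
        - now apply cont_ex_RInt.
        - apply (f_equal (fun z => z - RInt (fun x => x ^ 2 * gamma x) (- N) N)).
          apply (RInt_scal (V := R_CompleteNormedModule) gamma), cont_ex_RInt, cont_gamma. }
      replace (gamma (- N)) with (gamma N) in E by (unfold gamma; f_equal; ring).
      lra. }
    rewrite E.
    assert (HNg : N * gamma N <= eps / 2).
    { apply Rle_trans with (N * (1 / (1 + N ^ 2))).
      - apply Rmult_le_compat_l; [lra|apply gamma_le].
      - replace (N * (1 / (1 + N ^ 2))) with (N / (1 + N ^ 2)) by (field; nra).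
        apply Rle_div_l in HN2; [|lra].
        apply Rle_div_l; nra. }
    pose proof (gamma_pos N).
    assert (0 <= N * gamma N) by (apply Rmult_le_pos; lra).
    assert (Hhalf : Rabs (RInt gamma (- N) N - sqrt PI) <= eps) by lra.
    apply Rabs_le_between in Hhalf; apply Rabs_le; lra.
Qed.

(** * Expectations under the planar Gaussian *)

Lemma gauss_density_gamma y1 y2 : gauss_density (y1, y2) = / PI * gamma y1 * gamma y2.
Proof.
  unfold gauss_density, gamma; simpl fst; simpl snd.
  rewrite Rmult_assoc, <- exp_plus; do 2 f_equal; ring.
Qed.

Lemma gauss_expect_intro g h l :
  (forall y1, is_int (fun y2 => g (y1, y2) * gamma y2) (h y1)) ->
  is_int (fun y1 => / PI * gamma y1 * h y1) l ->
  gauss_expect g l.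
Proof.
  intros Hh Hl; exists (fun y1 => / PI * gamma y1 * h y1); split; [|exact Hl].
  intros y1; apply (is_int_ext (fun y2 => / PI * gamma y1 * (g (y1, y2) * gamma y2))).
  - intros y2; rewrite gauss_density_gamma; ring.
  - now apply is_int_scal.
Qed.

Lemma gauss_expect_ext f g l :
  (forall y, g y = f y) -> gauss_expect f l -> gauss_expect g l.
Proof.
  intros E (h & Hh & Hl); exists h; split; [|easy].
  intros y1; apply (is_int_ext (fun y2 => f (y1, y2) * gauss_density (y1, y2)));
    [intros y2; now rewrite E|exact (Hh y1)].
Qed.

Lemma gauss_expect_scal c f l : gauss_expect f l -> gauss_expect (fun y => c * f y) (c * l).
Proof.
  intros (h & Hh & Hl); exists (fun y1 => c * h y1); split; [|exact (is_int_scal c h l Hl)].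
  intros y1; apply (is_int_ext (fun y2 => c * (f (y1, y2) * gauss_density (y1, y2))));
    [intros y2; ring|].
  exact (is_int_scal c _ _ (Hh y1)).
Qed.

Lemma gauss_expect_plus f g l m :
  gauss_expect f l -> gauss_expect g m -> gauss_expect (fun y => f y + g y) (l + m).
Proof.
  intros (h & Hh & Hl) (k & Hk & Hm); exists (fun y1 => h y1 + k y1).
  split; [|exact (is_int_plus h k l m Hl Hm)].
  intros y1; apply (is_int_ext (fun y2 => f (y1, y2) * gauss_density (y1, y2)
    + g (y1, y2) * gauss_density (y1, y2))); [intros y2; ring|].
  exact (is_int_plus _ _ _ _ (Hh y1) (Hk y1)).
Qed.

Lemma gauss_expect_le f g l m :
  gauss_expect f l -> gauss_expect g m -> (forall y, f y <= g y) -> l <= m.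
Proof.
  intros (h & Hh & Hl) (k & Hk & Hm) Hfg; apply (is_int_le h k l m Hl Hm); intros y1.
  apply (is_int_le _ _ _ _ (Hh y1) (Hk y1)); intros y2.
  apply Rmult_le_compat_r; [|apply Hfg].
  rewrite gauss_density_gamma; apply Rlt_le.
  repeat apply Rmult_lt_0_compat; try apply gamma_pos; apply Rinv_0_lt_compat, PI_RGT_0.
Qed.

(** [gauss_expect] hides an existential inner integral, so uniqueness is a consequence of
    monotonicity. *)
Lemma gauss_expect_unique f l m : gauss_expect f l -> gauss_expect f m -> l = m.
Proof.
  intros H1 H2; apply Rle_antisym; eapply gauss_expect_le; try eassumption;
    intros; apply Rle_refl.
Qed.

(** The free phase in [is_int_cos_gamma] absorbs [xi1 * y1 + phi] in the inner integral. *)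
Lemma gauss_expect_cos xi1 xi2 phi :
  gauss_expect (fun y => cos (xi1 * fst y + xi2 * snd y + phi))
    (exp (- ((xi1 ^ 2 + xi2 ^ 2) / 4)) * cos phi).
Proof.
  assert (Hs : sqrt PI * sqrt PI = PI) by (apply sqrt_sqrt; pose proof PI_RGT_0; lra).
  pose proof PI_RGT_0 as HPI.
  apply (gauss_expect_intro _
    (fun y1 => sqrt PI * exp (- (xi2 ^ 2 / 4)) * cos (xi1 * y1 + phi))).
  - intros y1; apply (is_int_ext (fun y2 => cos (xi2 * y2 + (xi1 * y1 + phi)) * gamma y2));
      [|apply is_int_cos_gamma].
    intros y2; cbn [fst snd]; f_equal; f_equal; ring.
  - replace (exp (- ((xi1 ^ 2 + xi2 ^ 2) / 4)) * cos phi) with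
      (/ PI * sqrt PI * exp (- (xi2 ^ 2 / 4)) * (sqrt PI * exp (- (xi1 ^ 2 / 4)) * cos phi)).
    + apply (is_int_ext (fun y1 => / PI * sqrt PI * exp (- (xi2 ^ 2 / 4))
        * (cos (xi1 * y1 + phi) * gamma y1))); [intros y1; ring|].
      apply is_int_scal, is_int_cos_gamma.
    + replace (- ((xi1 ^ 2 + xi2 ^ 2) / 4)) with (- (xi1 ^ 2 / 4) + - (xi2 ^ 2 / 4)) by field.
      rewrite exp_plus.
      transitivity (/ PI * (sqrt PI * sqrt PI) * (exp (- (xi1 ^ 2 / 4)) * exp (- (xi2 ^ 2 / 4)) * cos phi));
        [ring|]. rewrite Hs; field; lra.
Qed.

Lemma gauss_expect_const c : gauss_expect (fun _ => c) c.
Proof.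
  pose proof (gauss_expect_scal c _ _ (gauss_expect_cos 0 0 0)) as H.
  replace (- ((0 ^ 2 + 0 ^ 2) / 4)) with 0 in H by field.
  rewrite exp_0, cos_0, !Rmult_1_r in H.
  refine (gauss_expect_ext _ _ _ _ H); intros y.
  rewrite !Rmult_0_l, !Rplus_0_l, cos_0; ring.
Qed.

Lemma gauss_expect_norm_sq : gauss_expect (fun y => fst y ^ 2 + snd y ^ 2) 1.
Proof.
  assert (Hs : sqrt PI * sqrt PI = PI) by (apply sqrt_sqrt; pose proof PI_RGT_0; lra).
  pose proof PI_RGT_0 as HPI.
  apply (gauss_expect_intro _ (fun y1 => y1 ^ 2 * sqrt PI + sqrt PI / 2)).
  - intros y1.
    apply (is_int_ext (fun y2 => y1 ^ 2 * gamma y2 + y2 ^ 2 * gamma y2));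
      [intros y2; simpl; ring|].
    apply is_int_plus; [apply is_int_scal, is_int_gamma|apply is_int_sq_gamma].
  - replace 1 with (/ PI * sqrt PI * (sqrt PI / 2) + / PI * (sqrt PI / 2) * sqrt PI).
    + apply (is_int_ext (fun y1 => / PI * sqrt PI * (y1 ^ 2 * gamma y1)
        + / PI * (sqrt PI / 2) * gamma y1)); [intros y1; field; lra|].
      apply is_int_plus; apply is_int_scal; [apply is_int_sq_gamma|apply is_int_gamma].
    + transitivity (/ PI * (sqrt PI * sqrt PI)); [field; lra|rewrite Hs; field; lra].
Qed.

(** Truncation to [- B, B] has an error uniform in the parameter; on the compact window uniform
    continuity of [f] finishes. *)
Lemma cont_int_param (f : R -> R -> R) (h : R -> R) K :
  (forall x y, continuity_2d_pt f x y) ->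
  (forall x, cont (f x)) ->
  (forall x y, Rabs (f x y) <= K / (1 + y ^ 2)) ->
  (forall x, is_int (f x) (h x)) ->
  cont h.
Proof.
  intros C2 C1 Hf Hh x0; pose proof PI_RGT_0.
  pose proof (dominated_nonneg (f 0) K (Hf 0)) as HK.
  apply filterlim_locally; intros [eps Heps].
  destruct (atan_tail_small (eps / 8 / (2 * K + 1))) as (B & HB & HB2);
    [apply Rdiv_lt_0_compat; lra|].
  apply Rlt_div_r in HB2; [|lra].
  assert (Hat : 2 * K * (PI / 2 - atan B) <= eps / 8) by (pose proof (atan_bound B); nra).
  assert (Happ : forall x, Rabs (RInt (f x) (- B) B - h x) <= eps / 8).
  { intros x; destruct (dominated_is_int (f x) K (C1 x) (Hf x)) as (l & Hl & _ & Ht).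
    rewrite (is_int_unique _ _ _ (Hh x) Hl).
    apply Rle_trans with (2 := Hat); apply Ht; lra. }
  destruct (uniform_continuity_2d f (x0 - 1) (x0 + 1) (- B) B (fun x y _ _ => C2 x y)
    (mkposreal (eps / 8 / B) ltac:(apply Rdiv_lt_0_compat; lra))) as [[del Hdel] Hu]; simpl in Hu.
  assert (Hm : 0 < Rmin del 1) by (apply Rmin_glb_lt; lra).
  exists (mkposreal _ Hm); intros x Hx.
  change (Rabs (x - x0) < Rmin del 1) in Hx; change (Rabs (h x - h x0) < eps).
  assert (Hx1 : Rabs (x - x0) < del) by (apply Rlt_le_trans with (1 := Hx), Rmin_l).
  assert (Hx2 : Rabs (x - x0) < 1) by (apply Rlt_le_trans with (1 := Hx), Rmin_r).
  apply Rabs_def2 in Hx2.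
  assert (E : RInt (fun y => f x y - f x0 y) (- B) B = RInt (f x) (- B) B - RInt (f x0) (- B) B)
    by (apply (RInt_minus (f x) (f x0)); now apply cont_ex_RInt).
  assert (HD : Rabs (RInt (fun y => f x y - f x0 y) (- B) B) <= (B - - B) * (eps / 8 / B)).
  { apply abs_RInt_le_const; [lra| |].
    - apply (ex_RInt_minus (f x) (f x0)); now apply cont_ex_RInt.
    - intros y Hy; apply Rlt_le, Hu; try lra. rewrite Rminus_diag, Rabs_R0; lra. }
  replace ((B - - B) * (eps / 8 / B)) with (eps / 4) in HD by (field; lra).
  rewrite E in HD; pose proof (Happ x) as A1; pose proof (Happ x0) as A2.
  apply Rabs_le_between in HD; apply Rabs_le_between in A1; apply Rabs_le_between in A2.
  apply Rabs_def1; lra.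
Qed.

(** The outer integral is reached only after the inner one is known to be continuous in [y1] and
    bounded by [M * PI]. *)
Lemma gauss_expect_exists g : bounded_continuous g -> exists l, gauss_expect g l.
Proof.
  intros Hg; pose proof (bounded_continuous_2d g Hg) as C2; pose proof PI_RGT_0 as HPI.
  destruct Hg as [Cg [M HM]].
  assert (HM0 : 0 <= M) by (apply Rle_trans with (2 := HM (0, 0)), Rabs_pos).
  set (f := fun y1 y2 => g (y1, y2) * gamma y2).
  assert (Cf2 : forall x y, continuity_2d_pt f x y).
  { intros x y; apply continuity_2d_pt_mult; [apply C2|].
    apply (continuity_1d_2d_pt_comp gamma (fun _ v => v));
      [apply continuity_pt_gamma|apply continuity_2d_pt_id2]. }
  assert (Cf : forall x, cont (f x)).
  { intros x y; apply continuity_pt_filterlim; intros e He.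
    destruct (Cf2 x y (mkposreal e He)) as [[del Hdel] H]; exists del; split; [easy|].
    intros z [_ Hz]; apply (H x z); [rewrite Rminus_diag, Rabs_R0; easy|exact Hz]. }
  assert (Bf : forall x y, Rabs (f x y) <= M / (1 + y ^ 2)).
  { intros x y; unfold f; rewrite Rabs_mult, (Rabs_right (gamma y)) by apply Rle_ge, Rlt_le, gamma_pos.
    replace (M / (1 + y ^ 2)) with (M * (1 / (1 + y ^ 2))) by (field; pose proof (pow2_ge_0 y); lra).
    apply Rmult_le_compat; [apply Rabs_pos|apply Rlt_le, gamma_pos|apply HM|apply gamma_le]. }
  set (h := fun x => RInt_gen (f x) (Rbar_locally m_infty) (Rbar_locally p_infty)).
  assert (Hh : forall x, is_int (f x) (h x) /\ Rabs (h x) <= M * PI).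
  { intros x; destruct (dominated_is_int (f x) M (Cf x) (Bf x)) as (l & Hl & Bl & _).
    replace (h x) with l; [easy|].
    symmetry; exact (is_RInt_gen_unique (f x) l Hl). }
  assert (Ch : cont h) by (apply (cont_int_param f h M); try easy; apply Hh).
  destruct (dominated_is_int (fun y1 => / PI * gamma y1 * h y1) M) as (l & Hl & _).
  - apply cont_mult; [apply cont_mult; [apply cont_const|apply cont_gamma]|easy].
  - intros x; pose proof (gamma_pos x); pose proof (Rinv_0_lt_compat _ HPI).
    rewrite !Rabs_mult, (Rabs_right (/ PI)), (Rabs_right (gamma x)) by lra.
    replace (M / (1 + x ^ 2)) with (/ PI * (1 / (1 + x ^ 2)) * (M * PI))
      by (field; pose proof (pow2_ge_0 x); lra).
    apply Rmult_le_compat; [|apply Rabs_pos| |apply Hh].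
    + apply Rmult_le_pos; lra.
    + apply Rmult_le_compat_l; [lra|apply gamma_le].
  - exists l; apply (gauss_expect_intro g h); [apply Hh|exact Hl].
Qed.

(** * Convergence in distribution *)

Lemma gauss_expect_dist_le f g b l m beta :
  gauss_expect f l -> gauss_expect g m -> gauss_expect b beta ->
  (forall y, Rabs (f y - g y) <= b y) -> Rabs (l - m) <= beta.
Proof.
  intros Hf Hg Hb H; apply Rabs_le; split.
  - enough (m <= l + beta) by lra.
    apply (gauss_expect_le g (fun y => f y + b y)); [easy|now apply gauss_expect_plus|].
    intros y; specialize (H y); apply Rabs_le_between in H; lra.
  - enough (l <= m + beta) by lra.
    apply (gauss_expect_le f (fun y => g y + b y)); [easy|now apply gauss_expect_plus|].
    intros y; specialize (H y); apply Rabs_le_between in H; lra.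
Qed.

(** * Normalised weights and the Lyapunov condition *)

Lemma sumR_sq_pos n d : (0 < n)%nat -> (forall j, (j < n)%nat -> 0 < d j) ->
  0 < sumR n (fun j => d j ^ 2).
Proof.
  intros Hn Hd; apply Rlt_le_trans with (d 0%nat ^ 2); [now apply pow_lt, Hd|].
  apply (sumR_term_le n (fun j => d j ^ 2)); [intros; apply pow2_ge_0|easy].
Qed.

Lemma DeltaZ_pos n d : (0 < n)%nat -> (forall j, (j < n)%nat -> 0 < d j) -> 0 < DeltaZ n d.
Proof. intros Hn Hd; now apply sqrt_lt_R0, sumR_sq_pos. Qed.

Lemma weight_pos n d j : (forall i, (i < n)%nat -> 0 < d i) -> (j < n)%nat ->
  0 < weight n d j.
Proof.
  intros Hd Hj; apply Rdiv_lt_0_compat; [now apply Hd|apply DeltaZ_pos; [lia|easy]].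
Qed.

Lemma DeltaZ_sq n d : DeltaZ n d ^ 2 = sumR n (fun j => d j ^ 2).
Proof.
  apply pow2_sqrt, sumR_nonneg; intros; apply pow2_ge_0.
Qed.

Lemma sumR_weight_sq n d : (0 < n)%nat -> (forall j, (j < n)%nat -> 0 < d j) ->
  sumR n (fun j => weight n d j ^ 2) = 1.
Proof.
  intros Hn Hd; pose proof (DeltaZ_pos n d Hn Hd); pose proof (sumR_sq_pos n d Hn Hd).
  rewrite (sumR_ext n _ (fun j => / DeltaZ n d ^ 2 * d j ^ 2)).
  - rewrite sumR_scal, DeltaZ_sq; field; lra.
  - intros j _; unfold weight; field; lra.
Qed.

Lemma weight_le_1 n d j : (forall i, (i < n)%nat -> 0 < d i) -> (j < n)%nat ->
  weight n d j <= 1.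
Proof.
  intros Hd Hj.
  assert (H : weight n d j ^ 2 <= 1).
  { rewrite <- (sumR_weight_sq n d) by (easy || lia).
    apply (sumR_term_le n (fun j => weight n d j ^ 2)); [intros; apply pow2_ge_0|easy]. }
  pose proof (weight_pos n d j Hd Hj); nra.
Qed.

Lemma Rq_weight n d : (0 < n)%nat -> (forall j, (j < n)%nat -> 0 < d j) ->
  Rq 2 n d = sumR n (fun j => weight n d j ^ 4).
Proof.
  intros Hn Hd; pose proof (DeltaZ_pos n d Hn Hd) as HD.
  pose proof (sumR_sq_pos n d Hn Hd) as HS; unfold Rq.
  replace (Rpower (sumR n (fun j => d j ^ 2)) 2) with (DeltaZ n d ^ 4).
  - unfold Rdiv; rewrite Rmult_comm, <- sumR_scal; apply sumR_ext; intros j Hj.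
    replace (2 * 2) with (INR 4) by (simpl; ring); rewrite Rpower_pow by now apply Hd.
    unfold weight; field; lra.
  - replace 2 with (INR 2) by (simpl; ring); rewrite Rpower_pow by easy.
    rewrite <- DeltaZ_sq; ring.
Qed.

Lemma Rq_nonneg q n d : 0 <= Rq q n d.
Proof.
  apply Rmult_le_pos; [apply sumR_nonneg; intros|apply Rlt_le, Rinv_0_lt_compat]; try apply Rlt_le;
    apply exp_pos.
Qed.

(** R_q^n is the sum of the (w_j^2)^q; one summand is kept. *)
Lemma Rpower_weight_le_Rq q n d j : (forall i, (i < n)%nat -> 0 < d i) -> (j < n)%nat ->
  Rpower (weight n d j ^ 2) q <= Rq q n d.
Proof.
  intros Hd Hj.
  pose proof (sumR_sq_pos n d ltac:(lia) Hd) as HS.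
  pose proof (weight_pos n d j Hd Hj) as Hw.
  pose proof (DeltaZ_pos n d ltac:(lia) Hd) as HD.
  unfold Rq; apply Rle_div_r; [apply Rlt_gt, exp_pos|].
  rewrite Rpower_mult_distr by (easy || now apply pow_lt).
  replace (weight n d j ^ 2 * sumR n (fun i => d i ^ 2)) with (Rpower (d j) 2).
  - rewrite Rpower_mult.
    apply (sumR_term_le n (fun i => Rpower (d i) (2 * q))); [|easy].
    intros; apply Rlt_le, exp_pos.
  - replace 2 with (INR 2) at 1 by (simpl; ring); rewrite Rpower_pow by now apply Hd.
    rewrite <- DeltaZ_sq; unfold weight; field; lra.
Qed.

Lemma lyapunov_weight_small d eta :
  (forall n j, (j < n)%nat -> 0 < d n j) -> lyapunov d -> 0 < eta ->
  exists N, forall n, (N <= n)%nat -> forall j, (j < n)%nat -> weight n (d n) j <= eta.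
Proof.
  intros Hd (q & Hq & Hlim) Heta; apply is_lim_seq_spec in Hlim.
  (* A weight above [eta] would push R_q^n to at least this value. *)
  destruct (Hlim (mkposreal (Rpower (eta ^ 2) q) (exp_pos _))) as [N HN]; simpl in HN.
  exists N; intros n Hn j Hj; specialize (HN n Hn).
  rewrite Rminus_0_r, Rabs_right in HN by apply Rle_ge, Rq_nonneg.
  apply Rnot_lt_le; intros Hlt.
  pose proof (Rpower_weight_le_Rq q n (d n) j (Hd n) Hj) as H.
  assert (Rpower (eta ^ 2) q <= Rpower (weight n (d n) j ^ 2) q); [|simpl in *; lra].
  apply Rle_Rpower_l; [lra|]; split; [now apply pow_lt|apply pow_incr; lra].
Qed.

Lemma sumR_weight_pow4_le n d eta :
  (0 < n)%nat -> (forall j, (j < n)%nat -> 0 < d j) ->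
  (forall j, (j < n)%nat -> weight n d j <= eta) ->
  sumR n (fun j => weight n d j ^ 4) <= eta ^ 2.
Proof.
  intros Hn Hd Hw.
  rewrite <- (Rmult_1_r (eta ^ 2)), <- (sumR_weight_sq n d Hn Hd), <- sumR_scal.
  apply sumR_le; intros j Hj; pose proof (weight_pos n d j Hd Hj); specialize (Hw j Hj).
  replace (weight n d j ^ 4) with (weight n d j ^ 2 * weight n d j ^ 2) by ring.
  apply Rmult_le_compat_r; [apply pow2_ge_0|apply pow_incr; lra].
Qed.

(** * Time averages along [Yn] *)

(** The bounds ask for [0 < n] because the squared weights of an empty sum do not add up to 1. *)
Lemma Yn_mean_cos n E d xi1 xi2 : Q_lin_indep n E ->
  let s := xi1 ^ 2 + xi2 ^ 2 in
  exists P,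
    (forall phi,
      almost_periodic (lattice n E)
        (fun t => cos (xi1 * fst (Yn n E d t) + xi2 * snd (Yn n E d t) + phi)) /\
      has_mean (fun t => cos (xi1 * fst (Yn n E d t) + xi2 * snd (Yn n E d t) + phi))
        (P * cos phi)) /\
    ((0 < n)%nat -> (forall j, (j < n)%nat -> 0 < d j) ->
     (forall j, (j < n)%nat -> s * weight n d j ^ 2 <= 1) ->
       let W := sumR n (fun j => weight n d j ^ 4) in
       exp (- (s / 4) - s ^ 2 * W / 8) <= P <= exp (- (s / 4) - s ^ 2 * W / 128)).
Proof.
  intros HE s.
  assert (Hs : 0 <= s) by (unfold s; pose proof (pow2_ge_0 xi1); pose proof (pow2_ge_0 xi2); lra).
  pose proof (pow2_sqrt s Hs) as Hr; pose proof (sqrt_pos s) as Hr0.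
  destruct (linear_form_Yn xi1 xi2) as [b Hb].
  destruct (osc_mean_cos n E b (fun j => sqrt s * weight n d j) HE) as (P & HP & BP).
  exists P; split.
  - intros phi; destruct (HP phi) as [H1 H2]; split.
    + refine (ap_ext _ _ _ _ H1); intros t; now rewrite Hb.
    + refine (has_mean_ext _ _ _ _ H2); intros t; now rewrite Hb.
  - intros Hn Hd Hw W.
    rewrite (sumR_ext n (fun j => (sqrt s * weight n d j) ^ 2) (fun j => s * weight n d j ^ 2)) in BP
      by (intros; rewrite Rpow_mult_distr, Hr; easy).
    rewrite (sumR_ext n (fun j => (sqrt s * weight n d j) ^ 4)
      (fun j => s ^ 2 * weight n d j ^ 4)) in BP
      by (intros; rewrite <- Hr at 2; ring).
    rewrite !sumR_scal, (sumR_weight_sq n d Hn Hd), Rmult_1_r in BP; fold W in BP.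
    replace (- (s / 4)) with (- s / 4) by field; apply BP.
    intros j Hj; specialize (Hw j Hj); pose proof (weight_pos n d j Hd Hj).
    rewrite Rabs_right by (apply Rle_ge, Rmult_le_pos; lra).
    rewrite <- Hr in Hw; rewrite <- Rpow_mult_distr in Hw.
    assert (0 <= sqrt s * weight n d j) by (apply Rmult_le_pos; lra); nra.
Qed.

Lemma trig_Yn_ap n E d Q : Q_lin_indep n E -> trig linear_form Q ->
  almost_periodic (lattice n E) (fun t => Q (Yn n E d t)).
Proof.
  intros HE HQ; induction HQ as [l phi f (xi1 & xi2 & El) Ef|c f1 f _ IH Ef|f1 f2 f _ IH1 _ IH2 Ef].
  - destruct (Yn_mean_cos n E d xi1 xi2 HE) as (P & HP & _).
    refine (ap_ext _ _ _ _ (proj1 (HP phi))); intros t; now rewrite Ef, El.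
  - refine (ap_ext _ _ _ _ (ap_scal _ c _ IH)); intros t; apply Ef.
  - refine (ap_ext _ _ _ _ (ap_plus _ _ _ IH1 IH2)); intros t; apply Ef.
Qed.

Lemma cont_Yn n E d g : (forall y : C, continuous g y) -> cont (fun t => g (Yn n E d t)).
Proof.
  intros Cg t.
  assert (C1 : cont (fun t => fst (Yn n E d t))).
  { apply (cont_ext (osc n E 0 (weight n d))); [apply fst_Yn|].
    eapply trig_cont, osc_trig. }
  assert (C2 : cont (fun t => snd (Yn n E d t))).
  { apply (cont_ext (osc n E (PI / 2) (weight n d))); [apply snd_Yn|].
    eapply trig_cont, osc_trig. }
  apply (continuous_ext (fun t => g (fst (Yn n E d t), snd (Yn n E d t)))).
  { intros z; f_equal; symmetry; apply surjective_pairing. }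
  apply (continuous_comp_2 (fun t => fst (Yn n E d t)) (fun t => snd (Yn n E d t))
    (fun u v => g (u, v)) t (C1 t) (C2 t)).
  apply (continuous_ext g); [intros [u v]; reflexivity|apply Cg].
Qed.

Lemma Yn_mean_norm_sq n E d : Q_lin_indep n E -> (forall j, (j < n)%nat -> 0 < d j) ->
  exists V, V <= 1 /\ has_mean (fun t => fst (Yn n E d t) ^ 2 + snd (Yn n E d t) ^ 2) V.
Proof.
  intros HE Hd; set (W := sumR n (fun j => weight n d j ^ 2)).
  exists (W / 2 + W / 2); split.
  - destruct n as [|n]; [unfold W, sumR; simpl; lra|].
    unfold W; rewrite sumR_weight_sq by (easy || lia); lra.
  - refine (has_mean_ext _ _ _ _ (has_mean_plus _ _ _ _
      (osc_mean_sq n E 0 (weight n d) HE) (osc_mean_sq n E (PI / 2) (weight n d) HE))).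
    intros t; now rewrite fst_Yn, snd_Yn.
Qed.

(** For fixed [n] the orbit is bounded, so the quadratic error becomes uniform in time. *)
Lemma Yn_ex_mean n E d g : Q_lin_indep n E -> bounded_continuous g ->
  exists mu, has_mean (fun t => g (Yn n E d t)) mu.
Proof.
  intros HE Hg; apply ex_mean_uniform_limit; [apply cont_Yn, Hg|]; intros eps Heps.
  destruct (trig_bounded _ _ (osc_trig n E 0 (weight n d))) as [M1 HM1].
  destruct (trig_bounded _ _ (osc_trig n E (PI / 2) (weight n d))) as [M2 HM2].
  set (K := 1 + (M1 ^ 2 + M2 ^ 2)).
  assert (HK : 0 < K) by (unfold K; pose proof (pow2_ge_0 M1); pose proof (pow2_ge_0 M2); lra).
  destruct (bounded_continuous_approx g (eps / K) Hg ltac:(now apply Rdiv_lt_0_compat))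
    as (Q & HQ & B).
  destruct (ap_ex_mean _ _ (trig_Yn_ap n E d Q HE HQ)) as [mu Hmu].
  exists (fun t => Q (Yn n E d t)), mu; split; [easy|]; intros t.
  apply Rle_trans with (1 := B (Yn n E d t)).
  replace eps with (eps / K * K) at 2 by (field; lra).
  apply Rmult_le_compat_l; [apply Rlt_le; now apply Rdiv_lt_0_compat|].
  rewrite fst_Yn, snd_Yn; unfold K; apply Rplus_le_compat_l.
  rewrite <- (pow2_abs (osc n E 0 _ t)), <- (pow2_abs (osc n E (PI / 2) _ t)).
  apply Rplus_le_compat; apply pow_incr; split; try apply Rabs_pos; easy.
Qed.

(** Quantifying over every mean avoids choosing one; existence is supplied separately. *)
Definition mean_limit (Y : nat -> R -> C) (g : C -> R) (l : R) : Prop :=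
  forall eps, 0 < eps -> exists N, forall n, (N <= n)%nat ->
    forall mu, has_mean (fun t => g (Y n t)) mu -> Rabs (mu - l) <= eps.

Lemma mean_limit_cos E d xi1 xi2 phi :
  (forall n, Q_lin_indep n (E n)) -> (forall n j, (j < n)%nat -> 0 < d n j) -> lyapunov d ->
  mean_limit (fun n => Yn n (E n) (d n)) (fun y => cos (xi1 * fst y + xi2 * snd y + phi))
    (exp (- ((xi1 ^ 2 + xi2 ^ 2) / 4)) * cos phi).
Proof.
  intros HE Hd Hly eps Heps; set (s := xi1 ^ 2 + xi2 ^ 2).
  assert (Hs : 0 <= s) by (unfold s; pose proof (pow2_ge_0 xi1); pose proof (pow2_ge_0 xi2); lra).
  (* A bound for w_j^2 that gives both [s * c <= 1], the range of the Bessel estimates, and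
     [s ^ 2 * c <= eps]. *)
  set (c := Rmin eps 1 / ((1 + s) * (1 + s))).
  assert (Hm : 0 < Rmin eps 1) by (apply Rmin_glb_lt; lra).
  assert (Hc : 0 < c) by (apply Rdiv_lt_0_compat; nra).
  assert (Hcs : c * ((1 + s) * (1 + s)) = Rmin eps 1) by (unfold c; field; lra).
  pose proof (Rmin_l eps 1) as Hm1; pose proof (Rmin_r eps 1) as Hm2.
  assert (Hc2 : sqrt c ^ 2 = c) by (apply pow2_sqrt; lra).
  destruct (lyapunov_weight_small d (sqrt c) Hd Hly ltac:(now apply sqrt_lt_R0)) as [N HN].
  (* The successor excludes [n = 0]. *)
  exists (S N); intros n Hn mu Hmu.
  specialize (HN n ltac:(lia)).
  destruct (Yn_mean_cos n (E n) (d n) xi1 xi2 (HE n)) as (P & HP & BP); fold s in BP.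
  rewrite (has_mean_unique _ _ _ Hmu (proj2 (HP phi))).
  pose proof (sumR_weight_pow4_le n (d n) (sqrt c) ltac:(lia) (Hd n) HN) as HW.
  rewrite Hc2 in HW.
  destruct (BP ltac:(lia) (Hd n)) as [L U].
  { intros j Hj; pose proof (weight_pos n (d n) j (Hd n) Hj); specialize (HN j Hj).
    assert (weight n (d n) j ^ 2 <= c) by (rewrite <- Hc2; apply pow_incr; lra).
    assert (s * weight n (d n) j ^ 2 <= s * c) by (apply Rmult_le_compat_l; easy). nra. }
  assert (HW0 : 0 <= sumR n (fun j => weight n (d n) j ^ 4)).
  { apply sumR_nonneg; intros j Hj; apply Rlt_le, pow_lt, weight_pos; [apply Hd|easy]. }
  set (W := sumR n (fun j => weight n (d n) j ^ 4)) in *.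
  assert (Hs2 : 0 <= s ^ 2 * W) by (apply Rmult_le_pos; [apply pow2_ge_0|easy]).
  assert (HsW : s ^ 2 * W <= eps).
  { apply Rle_trans with (s ^ 2 * c); [apply Rmult_le_compat_l; [apply pow2_ge_0|easy]|nra]. }
  set (x := exp (- (s / 4))).
  assert (Hx : 0 < x <= 1).
  { unfold x; split; [apply exp_pos|]; rewrite <- exp_0; apply exp_monotone; lra. }
  assert (U' : P <= x) by (apply Rle_trans with (1 := U), exp_monotone; lra).
  assert (L' : x - eps <= P).
  { apply Rle_trans with (2 := L); unfold Rminus at 2; rewrite exp_plus; fold x.
    pose proof (exp_ineq1_le (- (s ^ 2 * W / 8))); nra. }
  replace (P * cos phi - x * cos phi) with ((P - x) * cos phi) by ring.
  rewrite Rabs_mult.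
  assert (H1 : Rabs (P - x) <= eps) by (apply Rabs_le; lra).
  assert (H2 : Rabs (cos phi) <= 1) by apply Rabs_le, COS_bound.
  pose proof (Rabs_pos (P - x)); pose proof (Rabs_pos (cos phi)); nra.
Qed.

Lemma mean_limit_trig E d Q :
  (forall n, Q_lin_indep n (E n)) -> (forall n j, (j < n)%nat -> 0 < d n j) -> lyapunov d ->
  trig linear_form Q ->
  exists l, gauss_expect Q l /\ mean_limit (fun n => Yn n (E n) (d n)) Q l.
Proof.
  intros HE Hd Hly HQ.
  (* [mean_limit] starts from a given mean of the whole; its parts need means of their own. *)
  assert (Hex : forall f n, trig linear_form f ->
    exists mu, has_mean (fun t => f (Yn n (E n) (d n) t)) mu).
  { intros f n Hf; exact (ap_ex_mean _ _ (trig_Yn_ap n (E n) (d n) f (HE n) Hf)). }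
  induction HQ as [l phi f (xi1 & xi2 & El) Ef|c f1 f H1 IH Ef|f1 f2 f H1 IH1 H2 IH2 Ef].
  - exists (exp (- ((xi1 ^ 2 + xi2 ^ 2) / 4)) * cos phi); split.
    + refine (gauss_expect_ext _ _ _ _ (gauss_expect_cos xi1 xi2 phi)).
      intros y; now rewrite Ef, El.
    + intros eps Heps; destruct (mean_limit_cos E d xi1 xi2 phi HE Hd Hly eps Heps) as [N HN].
      exists N; intros n Hn mu Hmu; apply (HN n Hn).
      refine (has_mean_ext _ _ _ _ Hmu); intros t; now rewrite Ef, El.
  - destruct IH as (l & Gl & Ml); exists (c * l); split.
    + exact (gauss_expect_ext _ _ _ Ef (gauss_expect_scal c _ _ Gl)).
    + intros eps Heps.
      assert (Hc : 0 < Rabs c + 1) by (pose proof (Rabs_pos c); lra).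
      destruct (Ml (eps / (Rabs c + 1)) ltac:(now apply Rdiv_lt_0_compat)) as [N HN].
      exists N; intros n Hn mu Hmu; destruct (Hex f1 n H1) as [nu Hnu].
      assert (Emu : mu = c * nu).
      { apply (has_mean_unique _ _ _ Hmu).
        refine (has_mean_ext _ _ _ _ (has_mean_scal c _ _ Hnu)); intros t; apply Ef. }
      rewrite Emu, <- Rmult_minus_distr_l, Rabs_mult.
      specialize (HN n Hn nu Hnu); apply Rle_div_r in HN; [|easy].
      pose proof (Rabs_pos (nu - l)); nra.
  - destruct IH1 as (l1 & Gl1 & Ml1); destruct IH2 as (l2 & Gl2 & Ml2).
    exists (l1 + l2); split.
    + exact (gauss_expect_ext _ _ _ Ef (gauss_expect_plus _ _ _ _ Gl1 Gl2)).
    + intros eps Heps.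
      destruct (Ml1 (eps / 2) ltac:(lra)) as [N1 HN1].
      destruct (Ml2 (eps / 2) ltac:(lra)) as [N2 HN2].
      exists (N1 + N2)%nat; intros n Hn mu Hmu.
      destruct (Hex f1 n H1) as [nu1 Hnu1]; destruct (Hex f2 n H2) as [nu2 Hnu2].
      assert (Emu : mu = nu1 + nu2).
      { apply (has_mean_unique _ _ _ Hmu).
        refine (has_mean_ext _ _ _ _ (has_mean_plus _ _ _ _ Hnu1 Hnu2)); intros t; apply Ef. }
      specialize (HN1 n ltac:(lia) nu1 Hnu1); specialize (HN2 n ltac:(lia) nu2 Hnu2).
      apply Rabs_le_between in HN1; apply Rabs_le_between in HN2; apply Rabs_le; lra.
Qed.

Lemma mean_limit_bounded_continuous E d g l :
  (forall n, Q_lin_indep n (E n)) -> (forall n j, (j < n)%nat -> 0 < d n j) -> lyapunov d ->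
  bounded_continuous g -> gauss_expect g l ->
  mean_limit (fun n => Yn n (E n) (d n)) g l.
Proof.
  intros HE Hd Hly Hg Gl eps Heps.
  (* Two fifths for each law, whose mean of 1 + |y|^2 is at most 2, and one fifth for the
     convergence on [Q]. *)
  destruct (bounded_continuous_approx g (eps / 5) Hg ltac:(lra)) as (Q & HQ & B).
  destruct (mean_limit_trig E d Q HE Hd Hly HQ) as (m & Gm & Mm).
  assert (D1 : Rabs (l - m) <= eps / 5 * (1 + 1)).
  { apply (gauss_expect_dist_le g Q _ _ _ _ Gl Gm
      (gauss_expect_scal _ _ _ (gauss_expect_plus _ _ _ _ (gauss_expect_const 1)
        gauss_expect_norm_sq)) B). }
  destruct (Mm (eps / 5) ltac:(lra)) as [N HN]; exists N; intros n Hn mu Hmu.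
  destruct (ap_ex_mean _ _ (trig_Yn_ap n (E n) (d n) Q (HE n) HQ)) as [nu Hnu].
  specialize (HN n Hn nu Hnu).
  destruct (Yn_mean_norm_sq n (E n) (d n) (HE n) (Hd n)) as (V & HV & HmV).
  assert (D2 : Rabs (mu - nu) <= eps / 5 * (1 + V)).
  { apply (has_mean_dist_le _ _ _ _ _ _ Hmu Hnu
      (has_mean_scal (eps / 5) _ _ (has_mean_plus _ _ _ _ (has_mean_const 1) HmV))).
    intros t; apply B. }
  apply Rabs_le_between in D1; apply Rabs_le_between in D2; apply Rabs_le_between in HN.
  apply Rabs_le; split; nra.
Qed.

Lemma conv_gauss_of_lyapunov E d :
  (forall n, Q_lin_indep n (E n)) -> (forall n j, (j < n)%nat -> 0 < d n j) -> lyapunov d ->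
  conv_gauss (fun n => Yn n (E n) (d n)).
Proof.
  intros HE Hd Hly g Hg.
  destruct (gauss_expect_exists g Hg) as [l Gl].
  (* The total operator [Lim] turns existence for each [n] into a sequence without choice. *)
  set (a := fun n => real (Lim (fun T => RInt (fun t => g (Yn n (E n) (d n) t)) 0 T / T) p_infty)).
  assert (Ha : forall n, has_mean (fun t => g (Yn n (E n) (d n) t)) (a n)).
  { intros n; destruct (Yn_ex_mean n (E n) (d n) g (HE n) Hg) as [mu Hmu].
    replace (a n) with mu; [easy|].
    unfold a; rewrite (is_lim_unique _ _ (Finite mu)); [easy|exact (proj2 Hmu)]. }
  exists a; split; [intros n; apply Ha|].
  exists l; split; [easy|]; apply is_lim_seq_spec; intros [eps Heps]; simpl.
  destruct (mean_limit_bounded_continuous E d g l HE Hd Hly Hg Gl (eps / 2) ltac:(lra)) as [N HN].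
  exists N; intros n Hn; specialize (HN n Hn (a n) (Ha n)); lra.
Qed.

Lemma bounded_continuous_cos_fst : bounded_continuous (fun y => cos (fst y)).
Proof.
  split.
  - intros y; apply (continuous_comp (fst : C -> R) cos); [|apply continuous_cos].
    apply (continuous_fst (U := R_UniformSpace) (V := R_UniformSpace)).
  - exists 1; intros y; apply Rabs_le, COS_bound.
Qed.

(** At a unit [xi] the condition w_j <= 1 always holds, so the Bessel bounds apply for every
    [n >= 1]. The logarithm of the upper one bounds R_2^n by 128 times a gap that closes by
    continuity of [ln]. *)
Lemma lyapunov_of_conv_gauss E d :
  (forall n, Q_lin_indep n (E n)) -> (forall n j, (j < n)%nat -> 0 < d n j) ->
  conv_gauss (fun n => Yn n (E n) (d n)) -> lyapunov d.
Proof.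
  intros HE Hd Hconv.
  destruct (Hconv _ bounded_continuous_cos_fst) as (a & Ha & l & Gl & Hl).
  assert (El : l = exp (- / 4)).
  { apply (gauss_expect_unique _ _ _ Gl).
    replace (exp (- / 4)) with (exp (- ((1 ^ 2 + 0 ^ 2) / 4)) * cos 0).
    - refine (gauss_expect_ext _ _ _ _ (gauss_expect_cos 1 0 0)).
      intros y; f_equal; ring.
    - rewrite cos_0, Rmult_1_r; f_equal; field. }
  rewrite El in Hl.
  assert (Bound : forall n, (0 < n)%nat -> Rq 2 n (d n) <= 128 * (- / 4 - ln (a n))).
  { intros n Hn.
    destruct (Yn_mean_cos n (E n) (d n) 1 0 (HE n)) as (P & HP & BP).
    assert (EP : a n = P).
    { destruct (HP 0) as [_ H]; rewrite cos_0, Rmult_1_r in H.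
      refine (has_mean_unique _ _ _ (conj _ (Ha n)) (has_mean_ext _ _ _ _ H)).
      - apply (cont_Yn n (E n) (d n) (fun y => cos (fst y))), bounded_continuous_cos_fst.
      - intros t; f_equal; ring. }
    destruct (BP Hn (Hd n)) as [L U].
    { intros j Hj; pose proof (weight_pos n (d n) j (Hd n) Hj).
      pose proof (weight_le_1 n (d n) j (Hd n) Hj); nra. }
    rewrite <- (Rq_weight n (d n) Hn (Hd n)) in L, U; set (r := Rq 2 n (d n)) in *.
    (* The lower Bessel bound makes the logarithm meaningful. *)
    assert (HPpos : 0 < P) by (apply Rlt_le_trans with (2 := L), exp_pos).
    rewrite EP.
    assert (ln P <= - ((1 ^ 2 + 0 ^ 2) / 4) - (1 ^ 2 + 0 ^ 2) ^ 2 * r / 128); [|lra].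
    rewrite <- ln_exp; now apply ln_le. }
  exists 2; split; [lra|].
  apply (is_lim_seq_le_le_loc (fun _ => 0) _ (fun n => 128 * (- / 4 - ln (a n)))).
  - exists 1%nat; intros n Hn; split; [apply Rq_nonneg|apply Bound; lia].
  - apply is_lim_seq_const.
  - assert (Hln : is_lim_seq (fun n => ln (a n)) (- / 4)).
    { rewrite <- (ln_exp (- / 4)); apply (is_lim_seq_continuous ln a); [|exact Hl].
      apply derivable_continuous_pt; exists (/ exp (- / 4)).
      apply derivable_pt_lim_ln, exp_pos. }
    replace (Finite 0) with (Rbar_mult 128 (- / 4 - - / 4)).
    + apply is_lim_seq_scal_l, is_lim_seq_minus'; [apply is_lim_seq_const|exact Hln].
    + simpl; f_equal; ring.
Qed.

Theorem theorem2 (E d : nat -> nat -> R)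
  (hE : forall n, Q_lin_indep n (E n))
  (hd : forall n j, (j < n)%nat -> 0 < d n j) :
  (lyapunov d -> conv_gauss (fun n => Yn n (E n) (d n))) /\
  (~ lyapunov d -> ~ conv_gauss (fun n => Yn n (E n) (d n))).
Proof.
  split.
  - now apply conv_gauss_of_lyapunov.
  - intros Hly Hconv; apply Hly; now apply (lyapunov_of_conv_gauss E).
Qed.
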